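(* Let $F(z)=\sum_{k=0}^{n}A_kz^{n-k}\in\mathbb C[z]^{p\times p}$ be monic ($A_0=I_p$) of degree $n\ge2$, with even part $F_e$ and odd part $F_o$. Let $(\mathbf s_k)_{k\ge0}$ be the sequence of right Markov parameters of $F$ if $n=2m$, or of right Markov parameters of second type if $n=2m+1$, and assume $\mathbf s_0,\dots,\mathbf s_{n-1}$ are Hermitian. For matrices $\mathbf c_1,\dots,\mathbf c_n\in\mathbb C^{p\times p}$ and a choice of which indices carry a factor $z$, define rational matrix functions $R_{n-1}(z)=z\mathbf c_{n-1}+\mathbf c_n^{-1}$ and $R_j(z)=d_j(z)+R_{j+1}(z)^{-1}$ for $j=n-2,\dots,1$. (i) If $n=2m$, take $d_j(z)=z\mathbf c_j$ for odd $j$ and $d_j(z)=\mathbf c_j$ for even $j$. Then $F$ is a Hurwitz matrix polynomial if and only if there exist positive definite $\mathbf c_1,\dots,\mathbf c_n\in\mathbb C^{p\times p}$ such that $F_o(z)F_e(z)^{-1}=R_1(z)^{-1}$ for all large enough $z\in\mathbb C$. (ii) If $n=2m+1$, take $d_j(z)=\mathbf c_j$ for odd $j$ and $d_j(z)=z\mathbf c_j$ for even $j$. Then the following are equivalent: (a) $F$ is a Hurwitz matrix polynomial; (b) there exist positive definite $\mathbf c_1,\dots,\mathbf c_n$ such that $F_e(z)F_o(z)^{-1}=R_1(z)^{-1}$ for all large enough $z$; (c) $F_e$ is regular and there exist positive definite $\mathbf c_1,\dots,\mathbf c_n$ such that $F_o(z)F_e(z)^{-1}=R_1(z)$ for all large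 enough $z$.
   Context: Even/odd parts: if $n=2m$, $F_e(z)=\sum_{k=0}^mA_{2k}z^{m-k}$, $F_o(z)=\sum_{k=1}^mA_{2k-1}z^{m-k}$; if $n=2m+1$, $F_e(z)=\sum_{k=0}^mA_{2k+1}z^{m-k}$, $F_o(z)=\sum_{k=0}^mA_{2k}z^{m-k}$. Right Markov parameters ($n=2m$): $F_o(z)F_e(z)^{-1}=\sum_{k\ge0}(-1)^kz^{-(k+1)}\mathbf s_k$ for large $|z|$; right Markov parameters of second type ($n=2m+1$): $F_e(z)F_o(z)^{-1}=\sum_{k\ge0}(-1)^kz^{-k}\mathbf s_k$ for large $|z|$. Thus the continued fractions read, e.g. in case (i), $F_oF_e^{-1}=\big(z\mathbf c_1+(\mathbf c_2+(z\mathbf c_3+\cdots+(z\mathbf c_{n-1}+\mathbf c_n^{-1})^{-1}\cdots)^{-1})^{-1}\big)^{-1}$. A Hurwitz matrix polynomial is one all of whose roots of $\det F(z)$ lie in $\operatorname{Re}z<0$; $F_e$ regular means $\det F_e\not\equiv0$. *)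

(* Defs.v *)
(* complex numbers are  complex R = R[i]  for  R : realType
   (so R[i] is the field of complex numbers). *)
From HB Require Import structures.
From mathcomp Require Import all_boot all_order all_algebra.
From mathcomp Require Import complex.
From mathcomp Require Import reals.
Set Implicit Arguments. Unset Strict Implicit. Unset Printing Implicit Defensive.
Import Order.TTheory GRing.Theory Num.Theory.
Local Open Scope ring_scope.

Section Defs.
Variables (R : realType) (p : nat).
Local Notation C := (complex R).
Local Notation M := 'M[C]_p.

(* conjugate transpose *)
Definition mxH (q r : nat) (X : 'M[C]_(q, r)) : 'M[C]_(r, q) :=
  (map_mx (fun x : C => x^*) X)^T.

Definition is_hermitian (X : M) : Prop := mxH X = X.

(* (Hermitian) positive definite matrix *)
Definition posdef (X : M) : Prop :=
  is_hermitian X /\ forall v : 'cV[C]_p, v != 0 -> 0 < (mxH v *m X *m v) 0 0.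

(* F(z) = \sum_{k=0}^n A_k z^{n-k} *)
Definition mxpoly_eval (n : nat) (A : nat -> M) (z : C) : M :=
  \sum_(k < n.+1) (z ^+ (n - k)) *: A k.

(* Hurwitz: every root of det F(z) lies in the open left half-plane *)
Definition hurwitz (n : nat) (A : nat -> M) : Prop :=
  forall z : C, \det (mxpoly_eval n A z) = 0 -> 'Re z < 0.

(* even / odd parts, case n = 2m *)
Definition Fe_even (m : nat) (A : nat -> M) (z : C) : M :=
  \sum_(k < m.+1) (z ^+ (m - k)) *: A (k.*2).
Definition Fo_even (m : nat) (A : nat -> M) (z : C) : M :=
  \sum_(1 <= k < m.+1) (z ^+ (m - k)) *: A (k.*2.-1).
(* even / odd parts, case n = 2m+1 *)
Definition Fe_odd (m : nat) (A : nat -> M) (z : C) : M :=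
  \sum_(k < m.+1) (z ^+ (m - k)) *: A (k.*2.+1).
Definition Fo_odd (m : nat) (A : nat -> M) (z : C) : M :=
  \sum_(k < m.+1) (z ^+ (m - k)) *: A (k.*2).

(* entrywise convergence of the matrix series \sum_k u_k to L *)
Definition mx_series_to (u : nat -> M) (L : M) : Prop :=
  forall (i j : 'I_p) (eps : C), 0 < eps ->
    exists N : nat, forall K : nat, (N <= K)%N ->
      `|(\sum_(k < K) u k) i j - L i j| < eps.

(* right Markov parameters (n = 2m):
   F_o(z) F_e(z)^{-1} = \sum_k (-1)^k z^{-(k+1)} s_k  for large |z| *)
Definition right_markov (m : nat) (A : nat -> M) (s : nat -> M) : Prop :=
  exists r : R, forall z : C, (r%:C)%C < `|z| ->
    mx_series_to (fun k => ((-1) ^+ k * z ^- k.+1) *: s k)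
                 (Fo_even m A z *m invmx (Fe_even m A z)).

(* right Markov parameters of second type (n = 2m+1):
   F_e(z) F_o(z)^{-1} = \sum_k (-1)^k z^{-k} s_k  for large |z| *)
Definition right_markov2 (m : nat) (A : nat -> M) (s : nat -> M) : Prop :=
  exists r : R, forall z : C, (r%:C)%C < `|z| ->
    mx_series_to (fun k => ((-1) ^+ k * z ^- k) *: s k)
                 (Fe_odd m A z *m invmx (Fo_odd m A z)).

(* The continued fraction:  R_{n-1}(z) = z c_{n-1} + c_n^{-1},
   R_j(z) = d_j(z) + R_{j+1}(z)^{-1}, where d_j(z) = z c_j if zf j,
   and d_j(z) = c_j otherwise.  Rrec k j computes R_j when j = n-1-k. *)
Definition dterm (zf : nat -> bool) (c : nat -> M) (z : C) (j : nat) : M :=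
  if zf j then z *: c j else c j.

Fixpoint Rrec (zf : nat -> bool) (c : nat -> M) (z : C) (k j : nat) : M :=
  match k with
  | 0 => z *: c j + invmx (c j.+1)
  | k'.+1 => dterm zf c z j + invmx (Rrec zf c z k' j.+1)
  end.

Definition Rcf (n : nat) (zf : nat -> bool) (c : nat -> M) (z : C) (j : nat) : M :=
  Rrec zf c z (n.-1 - j) j.

(* case (i): z-factor at odd indices; case (ii): at even indices *)
Definition zf_even_case : nat -> bool := fun j => odd j.
Definition zf_odd_case : nat -> bool := fun j => ~~ odd j.

(* all R_j(z), 1 <= j <= n-1, are invertible *)
Definition Rcf_invertible (n : nat) (zf : nat -> bool) (c : nat -> M) (z : C) : Prop :=
  forall j : nat, (1 <= j <= n.-1)%N -> Rcf n zf c z j \in unitmx.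

Definition all_posdef (n : nat) (c : nat -> M) : Prop :=
  forall j : nat, (1 <= j <= n)%N -> posdef (c j).

(* regular: det F_e does not vanish identically *)
Definition mx_regular (P : C -> M) : Prop := ~ (forall z : C, \det (P z) = 0).

End Defs.

(* Main.v *)
(* Write [F = Y_0 + Y_1], where [Y_0] collects the powers of [z] of the parity of
   [n] and [Y_1] the others.  For [w = z^2] both continued fractions become
   [Y_0 Y_1^{-1} = T_1], [T_j = z c_j + T_{j+1}^{-1}], [T_n = z c_n], that is, a
   Euclidean chain [Y_{j-1} = z c_j Y_j + Y_{j+1}] ending with a constant [Y_n].
   If all [c_j] are positive definite and [F(z) v = 0] with [Re z >= 0], then
   summing [Re <Y_j v, Y_{j-1} v>] along the chain gives [Y_j(z) v = 0] for all
   [j], which is impossible for [Y_n].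
   Conversely, Hermitian Markov parameters make [Y_0(t)^* Y_1(t)] Hermitian for
   real [t], since the polynomial [t (Y_0^* Y_1 - Y_1^* Y_0)] stays bounded.  Hence
   [(u + v) K(u, v) = Y_0(u)^* Y_1(v) + Y_1(u)^* Y_0(v)] has a polynomial solution
   [K], a Hermitian block Bezoutian.  It satisfies a Lyapunov equation for the
   companion operator of [F], so stability makes it positive definite.  The Schur
   complement of its last block is the Bezoutian of [(Y_1, Y_2)], and that block
   gives a positive definite [c_1]; one concludes by induction on [n]. *)
Require Import Defs.
From HB Require Import structures.
From mathcomp Require Import all_boot all_order all_algebra.
From mathcomp Require Import ring zify complex.
From mathcomp Require Import reals.
Set Implicit Arguments. Unset Strict Implicit. Unset Printing Implicit Defensive.
Import Order.TTheory GRing.Theory Num.Theory.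
Local Open Scope ring_scope.

(** * Hermitian forms and the Lyapunov inertia theorem *)

Section HermitianForm.
Variable C : numClosedFieldType.

Definition hermitian_form (V : lmodType C) (K : V -> V -> C) :=
  (forall a x y z, K (a *: x + y) z = a * K x z + K y z) /\
  (forall x y, K y x = (K x y)^* ).

Section Theory.
Variables (V : lmodType C) (K : V -> V -> C).
Hypothesis hK : hermitian_form K.

Lemma hformC x y : K y x = (K x y)^*. Proof. by have [_ ->] := hK. Qed.

Lemma hform0l z : K 0 z = 0.
Proof.
by have := hK.1 (-1) 0 0 z; rewrite scaler0 addr0 mulN1r addNr.
Qed.

Lemma hformDl x y z : K (x + y) z = K x z + K y z.
Proof. by rewrite -[x in LHS]scale1r hK.1 mul1r. Qed.

Lemma hformZl a x z : K (a *: x) z = a * K x z.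
Proof. by rewrite -[_ *: _]addr0 hK.1 hform0l addr0. Qed.

Lemma hformDr x y z : K z (x + y) = K z x + K z y.
Proof. by rewrite hformC hformDl rmorphD /= -!hformC. Qed.

Lemma hformZr a x z : K z (a *: x) = a^* * K z x.
Proof. by rewrite hformC hformZl rmorphM /= -hformC. Qed.

(** As in the Cauchy-Schwarz inequality: if [K x y] were nonzero, moving [y] far enough along [x]
    would make the form negative. *)
Lemma psd_hform_radical x y : (forall z, 0 <= K z z) -> K x x = 0 -> K x y = 0.
Proof.
move=> pK kxx; apply/eqP; apply: contraT => nz.
(* This [s] gives the form the value [-1] at [y - s b^* x]. *)
set b := K x y in nz *; pose s := (K y y + 1) / (2 * (b * b^* )).
have bb : 0 < b * b^* by rewrite -normCK exprn_gt0 // normr_gt0.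
have s_real : s^* = s.
  by apply: conj_Creal; apply: ger0_real; rewrite divr_ge0 ?addr_ge0 // ltW // mulr_gt0 ?ltr0n.
have := pK (y + (- s * b^* ) *: x).
rewrite hformDl !hformDr !hformZl !hformZr kxx !mulr0 addr0 -/b (hformC x y) -/b.
rewrite rmorphM rmorphN /= conjCK s_real.
have -> : K y y + - s * b * b^* + - s * b^* * b = K y y - s * (2 * (b * b^* )).
  by ring.
rewrite /s divfK; last by rewrite mulf_neq0 // gt_eqF // ltr0n.
by rewrite opprD addNKr oppr_ge0 ler10.
Qed.

End Theory.

(** An eigenvector row is completed by [row_ebase] to an invertible matrix with rows [v] and [B],
    whose inverse has columns [q] and [P]. Thus [P] is the projection modulo [v] and [B] a section
    of it. *)
Lemma eigenvector_splitting N (S : 'M[C]_N.+1) :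
  exists l (v : 'rV_N.+1) (B : 'M_(N, N.+1)) (P : 'M_(N.+1, N)) (q : 'cV_N.+1),
   [/\ v != 0, v *m S = l *: v, v *m P = 0, B *m P = 1%:M &
       q *m v + P *m B = 1%:M].
Proof.
have [l /eigenvalueP[w wS w0]] := eigenvalue_closed S (ltn0Sn N).
pose E : 'M_(1 + N) := row_ebase w; pose Ei : 'M_(1 + N) := invmx E.
have EiE : Ei *m E = 1%:M by rewrite mulVmx // row_ebase_unit.
have EEi : E *m Ei = 1%:M by rewrite mulmxV // row_ebase_unit.
pose v := usubmx E; pose B := dsubmx E; pose q := lsubmx Ei; pose P := rsubmx Ei.
have EE : E = col_mx v B by rewrite vsubmxK.
have EiEq : Ei = row_mx q P by rewrite hsubmxK.
have v0w : exists a, w = a *: v.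
  exists (col_ebase w 0 0); rewrite -[LHS]mulmx_ebase.
  have -> : \rank w = 1%N by rewrite rank_rV w0.
  have rE : (row_mx 1%:M 0 : 'M_(1, 1 + N)) *m E = v.
    by rewrite EE mul_row_col mul1mx mul0mx addr0.
  rewrite (@pid_mx_row _ N 1) -mulmxA [_ *m row_ebase w]rE.
  by rewrite [col_ebase w in LHS]mx11_scalar mul_scalar_mx.
have [a wa] := v0w; exists l, v, B, P, q; split.
- by apply: contraNneq w0 => v0; rewrite wa v0 scaler0.
- move: wS; rewrite wa -scalemxAl scalerA mulrC -scalerA; apply: scalerI.
  by apply: contraNneq w0 => a0; rewrite wa a0 scale0r.
- by move: EEi; rewrite EE EiEq mul_col_row (@scalar_mx_block _ 1 N) => /eq_block_mx[].
- by move: EEi; rewrite EE EiEq mul_col_row (@scalar_mx_block _ 1 N) => /eq_block_mx[].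
- by rewrite -mul_row_col -EE -EiEq.
Qed.

(* The Lyapunov inertia theorem, by induction on the dimension: the form is
   split along an eigenvector, and [S] is compressed to the quotient.  A quotient
   eigenvector on which the form vanishes would lift to a true eigenvector. *)
Lemma lyapunov N (S : 'M[C]_N) (K : 'rV_N -> 'rV_N -> C) :
    hermitian_form K ->
    (forall x, K (x *m S) x + K x (x *m S) <= 0) ->
    (forall x l, x != 0 -> x *m S = l *: x -> 'Re l < 0 /\ 0 < K x x) ->
  forall x, x != 0 -> 0 < K x x.
Proof.
elim: N S K => [|N IH] S K hK dK eK; first by move=> x; rewrite [x]thinmx0 eqxx.
have [l [v [B [P [q [v0 vS vP BP qvPB]]]]]] := eigenvector_splitting S.
have [rl kv] := eK v l v0 vS.
(* Gram-Schmidt: [phi] lifts a quotient vector to the [K]-orthogonal complement of [v]. *)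
pose al y := K (y *m B) v / K v v.
pose phi (y : 'rV_N) := y *m B - al y *: v.
have phiP y : phi y *m P = y.
  by rewrite mulmxBl -mulmxA BP mulmx1 -scalemxAl vP scaler0 subr0.
have phiv y : K (phi y) v = 0.
  rewrite /phi -scaleNr (hformDl hK) (hformZl hK) mulNr divfK ?subrr //.
  by rewrite gt_eqF.
have phiL a y z : phi (a *: y + z) = a *: phi y + phi z.
  rewrite /phi /al mulmxDl -scalemxAl (hformDl hK) (hformZl hK).
  rewrite mulrDl -mulrA scalerDl -scalerA scalerBr opprD !addrA; congr (_ + _).
  by rewrite -!addrA; congr (_ + _); rewrite addrC.
have phiE y : y *m B = phi y + al y *: v by rewrite subrK.
pose S' := B *m S *m P.
have phiS y : exists b, phi y *m S = phi (y *m S') + b *: v.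
  pose w := phi y *m S.
  have wP : w *m P = y *m S'.
    rewrite /w /phi mulmxBl mulmxBl -scalemxAl vS -!scalemxAl vP !scaler0 subr0.
    by rewrite /S' !mulmxA.
  exists ((w *m q) 0 0 + al (w *m P)); rewrite -wP -/w.
  rewrite -[LHS]mulmx1 -qvPB mulmxDr !mulmxA.
  rewrite [w *m q in LHS]mx11_scalar mul_scalar_mx /phi scalerDl.
  by rewrite addrACA addNr addr0 addrC.
have phi0 : phi 0 = 0 by rewrite /phi /al mul0mx (hform0l hK) mul0r scale0r subr0.
clearbody phi; pose K' y z := K (phi y) (phi z).
have hK' : hermitian_form K'.
  by split=> [a x y z|x y]; [rewrite /K' phiL hK.1 | rewrite /K' (hformC hK)].
have vphi y : K v (phi y) = 0 by rewrite (hformC hK) phiv rmorph0.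
have IH' : forall y, y != 0 -> 0 < K' y y.
  apply: (IH S') => // [y|y m y0 yS].
    have [b E] := phiS y; have := dK (phi y); rewrite E.
    by rewrite (hformDl hK) (hformDr hK) (hformZl hK) (hformZr hK) phiv vphi
      !mulr0 !addr0.
  have [b] := phiS y; rewrite yS -[m *: y]addr0 phiL.
  rewrite phi0 addr0; set x := phi y => xS.
  have nz (c : C) : x + c *: v != 0.
    apply: contraNneq y0 => /(congr1 (mulmx^~ P)).
    by rewrite mulmxDl /x phiP -scalemxAl vP scaler0 addr0 mul0mx => ->.
  (* For [m != l], adding [b / (m - l)] times [v] to the lift gives an eigenvector of [S] for
     [m]. *)
  have rm : 'Re m < 0.
    have [->//|ml] := eqVneq m l.
    have := eK (x + (b / (m - l)) *: v) m (nz _).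
    case=> //; rewrite mulmxDl xS -scalemxAl vS scalerDr -addrA; congr (_ + _).
    rewrite !scalerA -scalerDl; congr (_ *: _).
    by field; rewrite subr_eq0.
  have Qx : K (x *m S) x + K x (x *m S) = 2 * 'Re m * K x x.
    rewrite xS (hformDl hK) (hformDr hK) !(hformZl hK) !(hformZr hK) phiv vphi.
    by rewrite !mulr0 !addr0 ReE; field.
  have m20 : 2 * 'Re m < 0 by rewrite pmulr_rlt0 ?ltr0n.
  have := dK x; rewrite Qx nmulr_rle0 // le_eqVlt => /orP[/eqP k0|//].
  (* If [K x x = 0], then [x] is a null vector of the semidefinite form [Q], so [Q x v = 0]. This
     forces [b = 0], and [x] is a genuine eigenvector with [K x x = 0], against [eK]. *)
  pose Q u w := - (K (u *m S) w + K u (w *m S)).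
  have hQ : hermitian_form Q.
    split=> [a u w t|u w]; rewrite /Q.
      by rewrite mulmxDl -scalemxAl !hK.1; ring.
    by rewrite rmorphN rmorphD /= -!(hformC hK) addrC.
  have := @psd_hform_radical _ Q hQ x v.
  rewrite /Q Qx -k0 mulr0 oppr0 vS (hformZr hK) phiv mulr0 addr0 => /(_ _ erefl).
  move=> H; have {}H: - K (x *m S) v = 0.
    by apply: H => z; rewrite oppr_ge0.
  move: H; rewrite xS (hformDl hK) !(hformZl hK) phiv mulr0 add0r => /eqP.
  rewrite oppr_eq0 mulf_eq0 [K v v == 0]gt_eqF // orbF => /eqP b0.
  have x0 : x != 0 by have := nz 0; rewrite scale0r addr0.
  move: xS; rewrite b0 scale0r addr0 => xS.
  by have [_] := eK x m x0 xS; rewrite /K' -/x -k0 ltxx.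
move=> x x0; pose y := x *m P.
have Ex : exists a, x = a *: v + phi y.
  exists ((x *m q) 0 0 + al y); rewrite -[LHS]mulmx1 -qvPB mulmxDr !mulmxA.
  rewrite [x *m q in LHS]mx11_scalar mul_scalar_mx -/y phiE scalerDl.
  by rewrite -addrA [phi y + _]addrC addrA.
have [a {}Ex] := Ex.
rewrite Ex (hformDl hK) !(hformDr hK) !(hformZl hK) !(hformZr hK) phiv vphi !mulr0.
rewrite addr0 add0r mulrA -normCK.
have aK : 0 <= `|a| ^+ 2 * K v v by rewrite mulr_ge0 ?exprn_ge0 // ltW.
have [y0|y0] := eqVneq y 0; last by rewrite ltr_wpDl // IH'.
have p0 : phi y = 0 by rewrite y0.
rewrite p0 (hform0l hK) addr0 mulr_gt0 // exprn_gt0 // normr_gt0.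
by apply: contraNneq x0 => a0; rewrite Ex a0 p0 scale0r addr0.
Qed.

End HermitianForm.

(** * Properties that hold for all large complex arguments *)

Section LargeArguments.
Variable R : realType.
Local Notation C := (complex R).

(** The threshold is real so that this unfolds to the quantifiers used in the Markov series and in
    the theorem. *)
Definition for_large (P : C -> Prop) :=
  exists r : R, forall z : C, (r%:C)%C < `|z| -> P z.

Lemma for_largeI (r : C) (P : C -> Prop) :
  0 <= r -> (forall z, r < `|z| -> P z) -> for_large P.
Proof.
move=> r0 rP; have /complex_realP[s rs] := ger0_real r0.
by exists s => z; rewrite -rs; apply: rP.
Qed.

Lemma for_largeE (P : C -> Prop) : for_large P ->
  exists2 r : C, 0 < r & forall z, r < `|z| -> P z.
Proof.
case=> r rP; exists ((`|r| + 1)%:C)%C => [|z rz].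
  by rewrite ltcR ltr_wpDl.
by apply: rP; apply: le_lt_trans rz; rewrite lecR ler_wpDr // ler_norm.
Qed.

Lemma for_largeW (P Q : C -> Prop) :
  (forall z, P z -> Q z) -> for_large P -> for_large Q.
Proof. by move=> PQ [r rP]; exists r => z /rP /PQ. Qed.

Lemma for_large_and (P Q : C -> Prop) :
  for_large P -> for_large Q -> for_large (fun z => P z /\ Q z).
Proof.
case=> r rP [s sQ]; exists (Num.max r s) => z rz.
by split; [apply: rP|apply: sQ]; apply: le_lt_trans rz; rewrite lecR le_max lexx ?orbT.
Qed.

Lemma for_large_gt (r : C) : 0 <= r -> for_large (fun z => r < `|z|).
Proof. by move=> r0; apply: for_largeI r0 _. Qed.

Lemma for_large_neq0 : for_large (fun z => z != 0).
Proof.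
by apply: for_largeW (for_large_gt (lexx 0)) => z; rewrite normr_gt0.
Qed.

Lemma for_large_ex (P : C -> Prop) : for_large P -> exists z, P z.
Proof.
move=> /for_largeE[r r0 rP]; exists (r + 1); apply: rP.
by rewrite ger0_norm ?ltrDl ?ltr01 // addr_ge0 // ltW.
Qed.

Lemma for_large_sqr (P : C -> Prop) :
  for_large P -> for_large (fun z => P (z ^+ 2)).
Proof.
move=> /for_largeE[r r0 rP]; apply: (@for_largeI (r + 1)) => [|z rz].
  by rewrite addr_ge0 // ltW.
apply: rP; rewrite normrX; apply: lt_le_trans (_ : r + 1 <= _).
  by rewrite ltrDl.
have z1 : 1 <= `|z| by rewrite ltW // (le_lt_trans _ rz) // lerDr ltW.
by rewrite (le_trans (ltW rz)) // expr2 ler_peMl.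
Qed.

(** Every complex number is a square. This returns from the variable [z] of the Euclidean chain to
    the variable [w = z^2] of the continued fractions. *)
Lemma for_large_sqrt (P : C -> Prop) :
  for_large (fun z => P (z ^+ 2)) -> for_large P.
Proof.
move=> /for_largeE[r r0 rP]; apply: (@for_largeI (r ^+ 2)) => [|z rz].
  by rewrite exprn_ge0 // ltW.
rewrite -[z]sqrtCK; apply: rP; rewrite -(ltr_pXn2r (ltn0Sn 1)) ?nnegrE ?normr_ge0 ?(ltW r0) //.
by rewrite -normrX sqrtCK.
Qed.

Lemma poly_neq0_large (q : {poly C}) :
  q != 0 -> for_large (fun z => q.[z] != 0).
Proof.
move=> q0; have [rs Eq] := closed_field_poly_normal q.
(* The sum of the moduli of the roots bounds each of them. *)
apply: (@for_largeI (\sum_(x <- rs) `|x|)) => [|z]; first exact: sumr_ge0.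
apply: contraTneq => qz0; have : root q z by apply/eqP.
rewrite Eq rootZ ?lead_coef_eq0 // root_prod_XsubC => zrs.
by rewrite le_gtF // (big_rem _ zrs) /= lerDl sumr_ge0.
Qed.

Lemma poly_large_eq0 (q : {poly C}) : for_large (fun z => q.[z] = 0) -> q = 0.
Proof.
move=> qz; apply/eqP; apply: contraT => /poly_neq0_large /(for_large_and qz).
by move=> /for_large_ex[z [->]]; rewrite eqxx.
Qed.

End LargeArguments.

(** * Matrix polynomials as functions, and their invertibility at large arguments *)

Section MatrixPolynomialFunctions.
Variables (R : realType) (p : nat).
Local Notation C := (complex R).
Local Notation M := 'M[C]_p.
Implicit Types (y : nat -> M) (z : C).

Definition mpeval N y z : M := \sum_(i < N) z ^+ i *: y i.

Lemma mpeval_entry N y z i j : mpeval N y z i j = (\poly_(k < N) y k i j).[z].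
Proof.
by rewrite horner_poly summxE; apply: eq_bigr => k _; rewrite mxE mulrC.
Qed.

Lemma mpeval_large_eq0 N y :
  for_large (fun z => mpeval N y z = 0) -> forall i, (i < N)%N -> y i = 0.
Proof.
move=> y0 i iN; apply/matrixP=> a b; rewrite mxE.
have q0 : \poly_(k < N) y k a b = 0.
  apply: poly_large_eq0; apply: for_largeW y0 => z /matrixP/(_ a b).
  by rewrite mpeval_entry mxE.
by have := coef_poly N (fun k => y k a b) i; rewrite q0 coef0 iN.
Qed.

Lemma det_mpeval N y :
  exists q : {poly C}, forall z, q.[z] = \det (mpeval N y z).
Proof.
exists (\det (\matrix_(i, j) \poly_(k < N) y k i j)) => z.
rewrite -[LHS]/(horner_eval z _) -det_map_mx; congr (\det _).
by apply/matrixP=> i j; rewrite !mxE mpeval_entry.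
Qed.

Lemma mpeval_regular_large N y : ~ (forall z, \det (mpeval N y z) = 0) ->
  for_large (fun z => mpeval N y z \in unitmx).
Proof.
have [q qE] := det_mpeval N y => reg.
apply: for_largeW (poly_neq0_large (_ : q != 0)) => [z|].
  by rewrite qE unitmxE unitfE.
by apply: contra_notN reg => /eqP q0 z; rewrite -qE q0 horner0.
Qed.

(** If the determinant vanished identically, so would that of the reversed polynomial, whose value
    at [0] is the determinant of the leading coefficient. *)
Lemma mpeval_lead_unit_large N y : y N \in unitmx ->
  for_large (fun z => mpeval N.+1 y z \in unitmx).
Proof.
rewrite unitmxE unitfE => yN; apply: mpeval_regular_large => reg.
have [q qE] := det_mpeval N.+1 (fun i => y (N - i)%N).
have rev z : z != 0 ->
    mpeval N.+1 (fun i => y (N - i)%N) z^-1 = z ^- N *: mpeval N.+1 y z.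
  move=> z0; rewrite /mpeval scaler_sumr (reindex_inj rev_ord_inj) /=.
  apply: eq_bigr => i _; have iN : (i <= N)%N by rewrite -ltnS.
  rewrite subSS (subKn iN) scalerA; congr (_ *: _).
  rewrite -[X in z ^- X](subnK iN) exprD invfM exprVn -mulrA mulVf ?mulr1 //.
  exact: expf_neq0.
have q0 : 'X * q = 0.
  apply: poly_large_eq0; apply: for_largeW (@for_large_neq0 R) => z z0.
  rewrite hornerM qE -[z in mpeval _ _ z]invrK rev ?invr_eq0 //.
  by rewrite detZ reg !mulr0.
move/eqP: q0; rewrite mulf_eq0 polyX_eq0 /= => /eqP q0; move/eqP: yN; apply.
have := qE 0; rewrite q0 horner0 /mpeval big_ord_recl expr0 scale1r subn0.
by rewrite big1 ?addr0 // => i _; rewrite expr0n scale0r.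
Qed.

End MatrixPolynomialFunctions.

(** * The conjugate transpose *)

Section Adjoint.
Variable R : realType.
Local Notation C := (complex R).

Lemma mxHE m n (X : 'M[C]_(m, n)) i j : mxH X i j = (X j i)^*.
Proof. by rewrite !mxE. Qed.

Lemma mxHD m n (X Y : 'M[C]_(m, n)) : mxH (X + Y) = mxH X + mxH Y.
Proof. by apply/matrixP=> i j; rewrite !mxE rmorphD. Qed.

Lemma mxHN m n (X : 'M[C]_(m, n)) : mxH (- X) = - mxH X.
Proof. by apply/matrixP=> i j; rewrite !mxE rmorphN. Qed.

Lemma mxHB m n (X Y : 'M[C]_(m, n)) : mxH (X - Y) = mxH X - mxH Y.
Proof. by rewrite mxHD mxHN. Qed.

Lemma mxHZ m n a (X : 'M[C]_(m, n)) : mxH (a *: X) = a^* *: mxH X.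
Proof. by apply/matrixP=> i j; rewrite !mxE rmorphM. Qed.

Lemma mxH0 m n : mxH (0 : 'M[C]_(m, n)) = 0.
Proof. by apply/matrixP=> i j; rewrite !mxE rmorph0. Qed.

Lemma mxHK m n (X : 'M[C]_(m, n)) : mxH (mxH X) = X.
Proof. by apply/matrixP=> i j; rewrite !mxE conjCK. Qed.

Lemma mxHM m n q (X : 'M[C]_(m, n)) (Y : 'M[C]_(n, q)) :
  mxH (X *m Y) = mxH Y *m mxH X.
Proof.
apply/matrixP=> i j; rewrite !mxE rmorph_sum; apply: eq_bigr => k _.
by rewrite !mxE rmorphM mulrC.
Qed.

Lemma mxH_sum m n (I : Type) (r : seq I) (P : pred I) (F : I -> 'M[C]_(m, n)) :
  mxH (\sum_(i <- r | P i) F i) = \sum_(i <- r | P i) mxH (F i).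
Proof. exact: (big_morph _ (@mxHD m n) (mxH0 m n)). Qed.

Lemma mxH_unit n (X : 'M[C]_n) : (mxH X \in unitmx) = (X \in unitmx).
Proof. by rewrite unitmx_tr map_unitmx. Qed.

End Adjoint.

(** * The standard inner product and positive definite matrices *)

Section InnerProduct.
Variables (R : realType) (p : nat).
Local Notation C := (complex R).
Implicit Types (u v w : 'cV[C]_p) (X : 'M[C]_p).

Definition ip u v : C := (mxH u *m v) 0 0.

Lemma ipC u v : ip v u = (ip u v)^*.
Proof. by rewrite /ip -mxHE mxHM mxHK. Qed.

Lemma ipDr u v w : ip u (v + w) = ip u v + ip u w.
Proof. by rewrite /ip mulmxDr mxE. Qed.

Lemma ipZr a u v : ip u (a *: v) = a * ip u v.
Proof. by rewrite /ip -scalemxAr mxE. Qed.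

Lemma ipNr u v : ip u (- v) = - ip u v.
Proof. by rewrite -scaleN1r ipZr mulN1r. Qed.

Lemma ip0r u : ip u 0 = 0. Proof. by rewrite -[0](scale0r 0) ipZr mul0r. Qed.

Lemma ip0l u : ip 0 u = 0. Proof. by rewrite ipC ip0r rmorph0. Qed.

Lemma ip_mxH X u v : ip (X *m u) v = ip u (mxH X *m v).
Proof. by rewrite /ip mxHM mulmxA. Qed.

Lemma ip_ge0 u : 0 <= ip u u.
Proof.
by rewrite /ip mxE sumr_ge0 // => i _; rewrite mxHE mulrC -normCK exprn_ge0.
Qed.

Lemma ip_eq0 u : (ip u u == 0) = (u == 0).
Proof.
apply/eqP/eqP => [|->]; last exact: ip0r.
rewrite /ip mxE => /psumr_eq0P u0; apply/matrixP=> i j; rewrite mxE ord1.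
have /u0/(_ i isT)/eqP : forall k, true -> 0 <= mxH u 0 k * u k 0.
  by move=> k _; rewrite mxHE mulrC -normCK exprn_ge0.
by rewrite mxHE mulf_eq0 conjC_eq0 orbb => /eqP.
Qed.

Lemma posdef_ip X v : posdef X -> v != 0 -> 0 < ip v (X *m v).
Proof. by case=> _ pX /pX; rewrite -mulmxA. Qed.

Lemma posdef_ip_ge0 X v : posdef X -> 0 <= ip v (X *m v).
Proof.
move=> pX; have [->|/(posdef_ip pX)/ltW //] := eqVneq v 0.
by rewrite ip0l.
Qed.

Lemma unitmx_injP (X : 'M[C]_p) :
  (forall v, X *m v = 0 -> v = 0) -> X \in unitmx.
Proof.
move=> Xinj; rewrite -unitmx_tr -row_free_unit -kermx_eq0.
apply/eqP/row_matrixP => i; rewrite row0; apply: (can_inj (@trmxK _ _ _)).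
by rewrite trmx0; apply: Xinj; apply: (can_inj (@trmxK _ _ _));
   rewrite trmx_mul trmxK -row_mul mulmx_ker row0 trmx0.
Qed.

Lemma posdef_unit X : posdef X -> X \in unitmx.
Proof.
move=> pX; apply: unitmx_injP => v Xv0; apply/eqP; apply: contraT => v0.
by have := posdef_ip pX v0; rewrite Xv0 ip0r ltxx.
Qed.

End InnerProduct.

(** * The Euclidean chain of a continued fraction, and stability from positivity *)

Section EuclideanChain.
Variables (R : realType) (p : nat).
Local Notation C := (complex R).
Local Notation M := 'M[C]_p.
Implicit Types (y : nat -> M) (c : nat -> M) (z : C).

Definition vanishes_from n y := forall i, (n <= i)%N -> y i = 0.

(* The coefficients of [z Y(z)]. *)
Definition shift y i : M := if i is i'.+1 then y i' else 0.

(* The coefficients of [Y0(z) - z c Y1(z)]. *)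
Definition next_remainder y0 y1 (c : M) i : M := y0 i - c *m shift y1 i.

(* The sequence [Y_{j+2} = Y_j - z c_{j+1} Y_{j+1}]. *)
Fixpoint chain y0 y1 c j : nat -> M :=
  if j is j'.+1 then chain y1 (next_remainder y0 y1 (c 1%N)) (fun i => c i.+1) j'
  else y0.

(** [chain] recurses on its initial pair, which suits induction; this recovers the three-term
    recurrence at the far end. *)
Lemma chainSS y0 y1 c j : chain y0 y1 c j.+2 =
  next_remainder (chain y0 y1 c j) (chain y0 y1 c j.+1) (c j.+1).
Proof. by elim: j y0 y1 c => [|j IH] y0 y1 c //=; rewrite -IH. Qed.

Lemma vanishes_from_next m y0 y1 (c : M) :
  vanishes_from m y0 -> vanishes_from m.+1 y1 ->
  vanishes_from m.+2 (next_remainder y0 y1 c).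
Proof.
move=> v0 v1 [|i] // mi; rewrite /next_remainder /= v0 ?v1 ?mulmx0 ?subr0 //.
exact: ltnW (ltnW mi).
Qed.

(** A crude bound that grows with [j]: no cancellation of leading terms is assumed here. It only
    provides a common length for evaluating the chain. *)
Lemma vanishes_from_chain m y0 y1 c j :
  vanishes_from m y0 -> vanishes_from m.+1 y1 ->
  vanishes_from (m + j) (chain y0 y1 c j).
Proof.
elim: j m y0 y1 c => [|j IH] m y0 y1 c v0 v1 /=; first by rewrite addn0.
by rewrite addnS -addSn; apply: IH => //; apply: vanishes_from_next.
Qed.

Lemma mpeval_widen m N y z : (m <= N)%N -> vanishes_from m y ->
  mpeval N y z = mpeval m y z.
Proof.
move=> mN vy; rewrite /mpeval (big_ord_widen N (fun i => z ^+ i *: y i) mN).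
rewrite [RHS]big_mkcond; apply: eq_bigr => i _.
by case: ltnP => // /vy ->; rewrite scaler0.
Qed.

Lemma mpeval_next m N y0 y1 (c : M) z : vanishes_from m y1 -> (m < N)%N ->
  mpeval N (next_remainder y0 y1 c) z = mpeval N y0 z - z *: (c *m mpeval N y1 z).
Proof.
case: N => // N v1 mN.
rewrite /mpeval -[X in _ = X - _]addr0 -addrA.
have -> : z *: (c *m \sum_(i < N.+1) z ^+ i *: y1 i) =
          \sum_(i < N.+1) z ^+ i *: (c *m shift y1 i).
  rewrite big_ord_recr big_ord_recl /= v1 // scaler0 addr0 mulmx0 scaler0 add0r.
  rewrite mulmx_sumr scaler_sumr; apply: eq_bigr => i _.
  by rewrite -scalemxAr scalerA exprS.
rewrite add0r -sumrN -big_split; apply: eq_bigr => i _.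
by rewrite /next_remainder scalerBr.
Qed.

(* [Tfrac c z k j = z c_j + (z c_{j+1} + ... + (z c_{j+k})^{-1} ... )^{-1}] *)
Fixpoint Tfrac c z k j : M :=
  if k is k'.+1 then z *: c j + invmx (Tfrac c z k' j.+1) else z *: c j.

Lemma Tfrac_shift c z k j : Tfrac (fun i => c i.+1) z k j = Tfrac c z k j.+1.
Proof. by elim: k j => //= k IH j; rewrite IH. Qed.

(** The quotient is cleared of its denominator. Invertibility of the tails is recorded because
    [invmx] returns a singular matrix unchanged. *)
Definition fraction_expansion n c y0 y1 := for_large (fun z =>
  (forall j, (1 <= j <= n)%N -> Tfrac c z (n - j) j \in unitmx) /\
  mpeval n.+1 y0 z = Tfrac c z n.-1 1 *m mpeval n.+1 y1 z).

Section Terminates.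
Variables (n : nat) (c : nat -> M) (y0 y1 : nat -> M).
Hypothesis n0 : (0 < n)%N.
Hypothesis v0 : vanishes_from n.+1 y0.
Hypothesis v1 : vanishes_from n.+1 y1.
Hypothesis cf : fraction_expansion n c y0 y1.
Hypothesis pc : all_posdef n c.
Let N := (n.+1 + n).+4.
Let Y := chain y0 y1 c.

Let vY j : vanishes_from (n.+1 + j) (Y j).
Proof. by apply: vanishes_from_chain => // i ni; apply: v1; apply: ltnW. Qed.

Let evY j z : (j <= n)%N ->
  mpeval N (Y j.+2) z = mpeval N (Y j) z - z *: (c j.+1 *m mpeval N (Y j.+1) z).
Proof.
move=> jn; rewrite /Y chainSS; apply: mpeval_next (@vY _) _.
by rewrite /N; lia.
Qed.

Let Nn : (n.+1 <= N)%N.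
Proof. by rewrite /N; lia. Qed.

Let evY0 z : mpeval n.+1 y0 z = mpeval N (Y 0%N) z.
Proof. by rewrite -(mpeval_widen z Nn v0). Qed.

Let evY1 z : mpeval n.+1 y1 z = mpeval N (Y 1%N) z.
Proof. by rewrite -(mpeval_widen z Nn v1). Qed.

(** The expansion propagates to [Y_j = T_{j+1} Y_{j+1}]. Its last instance is [Y_{n-1} = z c_n Y_n],
    which leaves the remainder zero. *)
Let chain_end_eval : for_large (fun z => mpeval N (Y n.+1) z = 0).
Proof.
apply: for_largeW cf => z [uT T1].
have step j : (j < n)%N ->
    mpeval N (Y j) z = Tfrac c z (n - j.+1) j.+1 *m mpeval N (Y j.+1) z.
  elim: j => [|j IH] jn; first by rewrite subn1 -evY0 -evY1.
  have E : mpeval N (Y j) z = z *: (c j.+1 *m mpeval N (Y j.+1) z) +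
           invmx (Tfrac c z (n - j.+2) j.+2) *m mpeval N (Y j.+1) z.
    rewrite IH ?(ltnW jn) // -[in LHS](subnSK jn) /=.
    by rewrite mulmxDl -scalemxAl.
  have u2 : Tfrac c z (n - j.+2) j.+2 \in unitmx by apply: uT; rewrite jn.
  by rewrite evY ?E ?(ltnW (ltnW jn)) // addrC addKr mulKVmx.
have := step n.-1; rewrite prednK // leqnn subnn /= => /(_ isT) E.
have := @evY n.-1 z; rewrite prednK // => -> //; last exact: leq_pred.
by rewrite E -scalemxAl subrr.
Qed.

Let chain_end i : Y n.+1 i = 0.
Proof.
have [iN|iN] := ltnP i N; first exact: (mpeval_large_eq0 chain_end_eval iN).
by apply: vY; move: iN; rewrite /N; lia.
Qed.

(* Read backwards, each step of the chain multiplies the leading coefficient by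
   an invertible matrix and raises the degree by one; as [deg Y_0 <= n], the last
   term [Y_n] has degree 0. *)
Let chain_last d : (0 < d)%N -> Y n d = 0.
Proof.
have lead e : (0 < e)%N -> (forall i, (e < i)%N -> Y n i = 0) -> Y n e = 0.
  move=> e0 Yn.
  suff H k : (k <= n)%N -> [/\ forall i, (e + k < i)%N -> Y (n - k)%N i = 0,
     forall i, (e + k <= i)%N -> Y (n - k).+1 i = 0 &
     Y (n - k)%N (e + k)%N = 0 -> Y n e = 0].
    have [//|_ _] := H n; apply; rewrite subnn; apply: v0.
    by lia.
  elim: k => [|k IH] kn; first by rewrite subn0 addn0; split=> // i _; apply: chain_end.
  have [I1 I2 I3] := IH (ltnW kn).
  have E i : Y (n - k.+1)%N i.+1 = Y (n - k).+1 i.+1 + c (n - k)%N *m Y (n - k)%N i.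
    by rewrite -(subnSK kn) /Y chainSS /next_remainder /= subrK.
  have cu : c (n - k)%N \in unitmx.
    by apply: posdef_unit; apply: pc; rewrite subn_gt0 kn leq_subr.
  split.
  - move=> [|i] //; rewrite addnS ltnS => ki.
    by rewrite E I1 // I2 ?mulmx0 ?addr0 // leqW // ltnW.
  - by rewrite subnSK // => i; rewrite addnS => /I1.
  - by rewrite addnS E I2 ?leqW // add0r => /(congr1 (mulmx (invmx (c (n - k)%N))));
      rewrite mulKmx // mulmx0.
(* Downward induction on the index, started at the crude bound [vY]; [m] measures the distance to
   it. *)
have far m e : (0 < e)%N -> (n.+1 + n <= e + m)%N -> Y n e = 0.
  elim: m e => [|m IH] e e0 le; first by apply: vY; rewrite addn0 in le.
  apply: lead => // i ei; apply: IH; first exact: leq_trans ei.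
  by apply: leq_trans le _; rewrite -addSnnS leq_add2r.
by move=> d0; apply: far (leq_addl _ (n.+1 + n)).
Qed.

(** Let [Re z >= 0] and [e_j = Y_j(z) v]. Going back from [e_{n+1} = 0], each step adds
    [Re z <e_j, c_j e_j> >= 0] to the real part of [<e_j, e_{j-1}>], whereas [F(z) v = 0] makes
    [<e_1, e_0>] equal to [-|e_1|^2]. Hence all [e_j] vanish. *)
Lemma fraction_expansion_stable z (v : 'cV[C]_p) : y0 n \in unitmx -> v != 0 ->
  (mpeval n.+1 y0 z + mpeval n.+1 y1 z) *m v = 0 -> 'Re z < 0.
Proof.
move=> u0 nv Fv; rewrite real_ltNge ?Creal_Re ?real0 //.
apply: contra nv => rz; apply/eqP.
pose e j := mpeval N (Y j) z *m v.
have eSS j : (j <= n)%N -> e j.+2 = e j - z *: (c j.+1 *m e j.+1).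
  by move=> jn; rewrite /e evY // mulmxBl -scalemxAl mulmxA.
have eend : e n.+1 = 0.
  by rewrite /e /mpeval big1 ?mul0mx // => i _; rewrite chain_end scaler0.
have re_ge0 k : (k <= n)%N -> 0 <= 'Re (ip (e (n - k).+1) (e (n - k)%N)).
  elim: k => [|k IH] kn; first by rewrite subn0 eend ip0l raddf0.
  rewrite subnSK //; set j := (n - k)%N in IH *.
  have Ej : e (n - k.+1)%N = z *: (c j *m e j) + e j.+1.
    by rewrite /j -(subnSK kn) eSS ?leq_subr // addrC subrK.
  have pcj : posdef (c j) by apply: pc; rewrite /j subn_gt0 kn leq_subr.
  rewrite Ej ipDr ipZr raddfD /= [ip (e j) (e j.+1)]ipC Re_conj.
  rewrite addr_ge0 ?IH ?(ltnW kn) //.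
  by rewrite ReMr ?ger0_real ?posdef_ip_ge0 // mulr_ge0 // posdef_ip_ge0.
have e01 : e 0%N = - e 1%N.
  by apply/eqP; rewrite -addr_eq0 /e -mulmxDl -evY0 -evY1 Fv.
have e1 : e 1%N = 0.
  have := re_ge0 n (leqnn n); rewrite subnn e01 ipNr raddfN /= oppr_ge0 => le0.
  apply/eqP; rewrite -ip_eq0 eq_le ip_ge0 andbT.
  by rewrite -(Creal_ReP _ (ger0_real (ip_ge0 _))).
have e0 : e 0%N = 0 by rewrite e01 e1 oppr0.
have eall j : (j <= n)%N -> e j = 0 /\ e j.+1 = 0.
  elim: j => [|j IH] jn; first by [].
  by have [E1 E2] := IH (ltnW jn); rewrite eSS ?(ltnW jn) // E1 E2 mulmx0 scaler0 subrr.
have [en _] := eall n (leqnn n).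
have Ynw w : mpeval N (Y n) w = Y n 0%N.
  rewrite /mpeval big_ord_recl expr0 scale1r big1 ?addr0 // => i _.
  by rewrite chain_last ?scaler0.
rewrite /e Ynw in en.
(* Since [Y_n] is constant, it kills [v] at every point. The chain is climbed back at a point [w]
   where [Y_0] is invertible. *)
have [w wu] := for_large_ex (mpeval_lead_unit_large u0).
have back k : (k <= n)%N -> mpeval N (Y (n - k)%N) w *m v = 0 /\
    mpeval N (Y (n - k).+1) w *m v = 0.
  elim: k => [|k IH] kn.
    rewrite subn0 Ynw en; split=> //.
    by rewrite /mpeval big1 ?mul0mx // => i _; rewrite chain_end scaler0.
  have [E1 E2] := IH (ltnW kn); rewrite subnSK //; split=> //.
  have := evY w (leq_subr k.+1 n); rewrite subnSK // => /(congr1 (mulmx^~ v)).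
  by rewrite /= mulmxBl E2 -scalemxAl -mulmxA E1 mulmx0 scaler0 subr0.
have := (back n (leqnn n)).1; rewrite subnn -evY0 => H.
by rewrite -[v](mulKmx wu) H mulmx0.
Qed.

End Terminates.
End EuclideanChain.

(** * From a positive Bezoutian to positive definite coefficients *)

Section Descent.
Variables (R : realType) (p : nat).
Local Notation C := (complex R).
Local Notation M := 'M[C]_p.
Implicit Types (y : nat -> M) (c : nat -> M) (z : C) (K : nat -> nat -> M).

Definition bezout_rhs y0 y1 i j : M := mxH (y0 i) *m y1 j + mxH (y1 i) *m y0 j.

(* The coefficient of [u^i v^j] in [(u + v) K(u, v)]. *)
Definition bezout_lhs K i j : M :=
  (if i is i'.+1 then K i' j else 0) + (if j is j'.+1 then K i j' else 0).

Definition quad_form n K (x : nat -> 'cV[C]_p) : C :=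
  \sum_(i < n) \sum_(j < n) ip (x i) (K i j *m x j).

(** [K] is an array over all indices, cut off by its support conditions, so that the index shifts of
    [bezout_lhs] and the descent in [n] need no casts. *)
Record bezout_pair n y0 y1 K : Prop := BezoutPair {
  bezout_vanish0 : vanishes_from n.+1 y0;
  bezout_vanish1 : vanishes_from n y1;
  bezout_parity0 : forall i, odd (n + i) -> y0 i = 0;
  bezout_parity1 : forall i, ~~ odd (n + i) -> y1 i = 0;
  bezout_lead : y0 n \in unitmx;
  bezout_eq : forall i j, bezout_rhs y0 y1 i j = bezout_lhs K i j;
  bezout_supp_l : forall i j, (n <= i)%N -> K i j = 0;
  bezout_supp_r : forall i j, (n <= j)%N -> K i j = 0 }.

Definition positive_pair n y0 y1 K := bezout_pair n y0 y1 K /\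
  forall x, (exists2 i, (i < n)%N & x i != 0) -> 0 < quad_form n K x.

Section Step.
Variables (n : nat) (y0 y1 : nat -> M) (K : nat -> nat -> M).
Hypothesis pK : positive_pair n.+1 y0 y1 K.
Let bK := pK.1.
Let L := y0 n.+1.
Let L' := y1 n.
(** The ratio of leading coefficients, a true quotient by [step_lead_unit]. It cancels the leading
    term of [Y_0 - z c Y_1]. *)
Let c := L *m invmx L'.
Let y2 := next_remainder y0 y1 c.
(** Substituting [Y_0 = z c Y_1 + Y_2] with [c] Hermitian splits [(u + v) Y_1(u)^* c Y_1(v)] off the
    Bezout identity and leaves that of [(Y_1, Y_2)]. *)
Let K' i j := K i j - mxH (y1 i) *m c *m y1 j.

(** Compare the coefficients of [u^i v^(n+1)]: the other entry of [K] involved lies outside the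
    support. *)
Let Kin i : K i n = mxH (y1 i) *m L.
Proof.
have := bezout_eq bK i n.+1; rewrite /bezout_rhs /bezout_lhs.
rewrite (bezout_vanish1 bK (leqnn _)) mulmx0 add0r => ->.
by case: i => [|i]; rewrite ?add0r // [K i n.+1](bezout_supp_r bK) ?add0r.
Qed.

Let Knj j : K n j = mxH L *m y1 j.
Proof.
have := bezout_eq bK n.+1 j; rewrite /bezout_rhs /bezout_lhs.
rewrite (bezout_vanish1 bK (leqnn _)) mxH0 mul0mx addr0 => ->.
by case: j => [|j]; rewrite ?addr0 // [K n.+1 j](bezout_supp_l bK) ?addr0.
Qed.

Let Knn_pos v : v != 0 -> 0 < ip v (K n n *m v).
Proof.
move=> v0; have := pK.2 (fun i => if i == n then v else 0).
move=> /(_ (ex_intro2 _ _ n (ltnSn n) _)); rewrite eqxx => /(_ v0).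
rewrite /quad_form big_ord_recr /= big1 => [|i _]; last first.
  by apply: big1 => j _; rewrite ltn_eqF ?ip0l.
rewrite add0r big_ord_recr /= eqxx big1 ?add0r // => i _.
by rewrite ltn_eqF ?mulmx0 ?ip0r.
Qed.

(** The definite block [K n n] equals [mxH L *m L'], so [L'] is injective. *)
Lemma step_lead_unit : y1 n \in unitmx.
Proof.
apply: unitmx_injP => v Lv; apply/eqP; apply: contraT => /Knn_pos.
by rewrite Knj -mulmxA Lv mulmx0 ip0r ltxx.
Qed.

Let cL : c *m L' = L. Proof. by rewrite /c mulmxKV ?step_lead_unit. Qed.

(** Sandwiched between [mxH L'] and [L'], both sides become [K n n], by [Knj] and [Kin]. *)
Let c_herm : mxH c = c.
Proof.
have u := step_lead_unit; have uH : mxH L' \in unitmx by rewrite mxH_unit.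
apply: (can_inj (mulmxK u)); apply: (can_inj (mulKmx uH)).
by rewrite mulmxA -mxHM cL -Knj -Kin.
Qed.

(** [c] is congruent to [K n n] through [invmx L']. *)
Lemma step_posdef : posdef c.
Proof.
split=> [//|v v0]; have u := step_lead_unit.
have w0 : invmx L' *m v != 0.
  by apply: contraNneq v0 => w0; rewrite -[v](mulKVmx u) w0 mulmx0.
have := Knn_pos w0; rewrite Kin -[mxH _ *m _ *m _]mulmxA -ip_mxH mulKVmx //.
by rewrite /ip -!mulmxA.
Qed.

Let y2E i : y2 i = y0 i - c *m shift y1 i. Proof. by []. Qed.

Let K'_rel i j : bezout_rhs y1 y2 i j = bezout_lhs K' i j.
Proof.
have := bezout_eq bK i j; rewrite /bezout_rhs /bezout_lhs !y2E mxHB mxHM c_herm.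
rewrite mulmxBr mulmxBl mulmxA.
have -> a b d e : a - b + (d - e) = (d + a) - (e + b) :> M.
  by rewrite addrACA [a + d]addrC -opprD [b + e]addrC.
move=> ->; rewrite /K'; case: i => [|i]; case: j => [|j] /=;
  rewrite ?(mulmx0, mul0mx, mxH0, subr0, add0r, addr0, oppr0) //.
by rewrite opprD addrACA.
Qed.

Let K'_l i j : (n <= i)%N -> K' i j = 0.
Proof.
rewrite leq_eqVlt => /orP[/eqP <-|ni]; rewrite /K'.
  by rewrite Knj -[L in mxH L]cL mxHM c_herm subrr.
by rewrite [K i j](bezout_supp_l bK) // (bezout_vanish1 bK ni) mxH0 !mul0mx subr0.
Qed.

Let K'_r i j : (n <= j)%N -> K' i j = 0.
Proof.
rewrite leq_eqVlt => /orP[/eqP <-|ni]; rewrite /K'.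
  by rewrite Kin -mulmxA cL subrr.
by rewrite [K i j](bezout_supp_r bK) // (bezout_vanish1 bK ni) mulmx0 subr0.
Qed.

Let y2_parity i : ~~ odd (n + i) -> y2 i = 0.
Proof.
move=> ni; rewrite y2E (bezout_parity0 bK) ?addSn //=.
case: i ni => [|i] /= ni; rewrite ?mulmx0 ?subr0 //.
by rewrite (bezout_parity1 bK) ?mulmx0 ?subr0 // addSnnS.
Qed.

Lemma step_bezout_pair : bezout_pair n y1 y2 K'.
Proof.
split=> //.
- exact: bezout_vanish1 bK.
(* The new remainder loses two degrees: the coefficient [n] vanishes by parity, [n + 1] by the
   choice of [c], and the higher ones by the degrees of [Y_0] and [Y_1]. *)
- move=> i; rewrite leq_eqVlt => /orP[/eqP <-|].
    by apply: y2_parity; rewrite addnn odd_double.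
  rewrite leq_eqVlt => /orP[/eqP <-|]; first by rewrite y2E /= cL subrr.
  case: i => // i ni; rewrite y2E (bezout_vanish0 bK) //=.
  by rewrite (bezout_vanish1 bK) ?mulmx0 ?subr0.
- by move=> i ni; apply: (bezout_parity1 bK); rewrite addSn /= ni.
- exact: step_lead_unit.
Qed.

(* [K'] is the Schur complement of [K_nn] in [K]: the last block of the test
   vector is chosen to kill [\sum_j y1_j x_j]. *)
Lemma step_positive_pair : positive_pair n y1 y2 K'.
Proof.
split=> [|x [k kn xk]]; first exact: step_bezout_pair.
pose x' i := if (i < n)%N then x i else - (invmx L' *m \sum_(j < n) y1 j *m x j).
have x'_lt (i : 'I_n) : x' i = x i by rewrite /x' ltn_ord.
have s0 : \sum_(j < n.+1) y1 j *m x' j = 0.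
  rewrite big_ord_recr /= {2}/x' ltnn mulmxN mulKVmx ?step_lead_unit //.
  by apply/eqP; rewrite subr_eq0; apply/eqP/eq_bigr => j _; rewrite x'_lt.
have -> : quad_form n K' x = quad_form n.+1 K' x'.
  rewrite /quad_form [RHS]big_ord_recr /= [X in _ = _ + X]big1 ?addr0 => [|j _].
    apply: eq_bigr => i _; rewrite big_ord_recr /= K'_r // mul0mx ip0r addr0.
    by apply: eq_bigr => j _; rewrite !x'_lt.
  by rewrite K'_l // mul0mx ip0r.
have -> : quad_form n.+1 K' x' = quad_form n.+1 K x' -
    ip (\sum_(i < n.+1) y1 i *m x' i) (c *m \sum_(j < n.+1) y1 j *m x' j).
  rewrite /ip mxH_sum mulmx_sumr mulmx_suml summxE -sumrB; apply: eq_bigr => i _.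
  rewrite mulmx_sumr summxE -sumrB; apply: eq_bigr => j _.
  by rewrite /ip mulmxBl mulmxBr mxHM !mulmxA !mxE.
rewrite s0 ip0l subr0; apply: pK.2; exists k; first exact: leqW.
by rewrite /x' kn.
Qed.

End Step.

Lemma eq_Tfrac c c' z k j :
  (forall i, (j <= i)%N -> c i = c' i) -> Tfrac c z k j = Tfrac c' z k j.
Proof.
elim: k j => [|k IH] j cc /=; rewrite cc // IH // => i ji; exact/cc/ltnW.
Qed.

(** Each descent step peels off one coefficient. The new tail [T_1] is invertible because it is a
    left factor of [Y_0], which is invertible at large arguments. *)
Lemma positive_pair_expansion n y0 y1 K : positive_pair n.+1 y0 y1 K ->
  exists c, all_posdef n.+1 c /\ fraction_expansion n.+1 c y0 y1.
Proof.
elim: n y0 y1 K => [|n IH] y0 y1 K pK;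
  have pc := step_posdef pK; have pK' := step_positive_pair pK;
  have bK := pK.1; set c1 := _ *m _ in pc pK'; set y2 := next_remainder _ _ _ in pK';
  have v1 := bezout_vanish1 bK; have v2 := bezout_vanish1 pK'.1;
  have lu := mpeval_lead_unit_large (bezout_lead bK).
- exists (fun=> c1); split=> [j _ //|].
  apply: for_largeW lu => z u0.
  have E : mpeval 2 y0 z = z *: c1 *m mpeval 2 y1 z.
    have := mpeval_next y0 c1 z v1 (ltnSn 1).
    rewrite [LHS](mpeval_widen z (leq0n 2) v2) {1}/mpeval big_ord0 => /esym/eqP.
    by rewrite subr_eq0 scalemxAl => /eqP.
  split=> // j j1; have -> : j = 1%N by lia.
  by move: u0; rewrite E unitmx_mul => /andP[].
have [c' [pc' ec']] := IH _ _ _ pK'.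
pose c j := if j == 1%N then c1 else c' j.-1.
exists c; split; first by case=> [|[|j]] jn; [|exact: pc|apply: pc'; lia].
apply: for_largeW (for_large_and lu ec') => z [u0 [uT E1]].
have cT k j : Tfrac c z k j.+2 = Tfrac c' z k j.+1.
  by rewrite -Tfrac_shift; apply: eq_Tfrac => -[|[|i]].
have E0 : mpeval n.+3 y0 z = Tfrac c z n.+1 1 *m mpeval n.+3 y1 z.
  have := mpeval_next y0 c1 z v1 (ltnSn n.+2).
  have wv2 : vanishes_from n.+2 y2 by move=> i ni; apply: v2; apply: ltnW.
  rewrite -/y2 [LHS](mpeval_widen z (leqnSn _) wv2).
  rewrite (mpeval_widen z (leqnSn _) v1) => /esym/eqP; rewrite subr_eq => /eqP ->.
  rewrite /= cT mulmxDl scalemxAl /c eqxx addrC; congr (_ + _).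
  by rewrite E1 mulKmx //; have := uT 1%N isT; rewrite subn1.
split=> // -[|[|j]] // jn; last by rewrite cT subSS; apply: uT; lia.
by move: u0; rewrite E0 subn1 unitmx_mul => /andP[].
Qed.

End Descent.

(** * The Bezoutian and its positivity for a stable polynomial *)

Section BezoutianOfStable.
Variables (R : realType) (p : nat).
Local Notation C := (complex R).
Local Notation M := 'M[C]_p.

(** The coefficient of [u^(i+1) v^j] in the Bezout identity, solved for [K i j] column by column.
    The equations with [u^0] are left over; they are settled by [B0j] and parity. *)
Fixpoint bezout (y0 y1 : nat -> M) i j {struct j} : M :=
  if j is j'.+1 then bezout_rhs y0 y1 i.+1 j - bezout y0 y1 i.+1 j'
  else bezout_rhs y0 y1 i.+1 0.

Lemma bezout_rhs_herm (y0 y1 : nat -> M) i j :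
  mxH (bezout_rhs y0 y1 i j) = bezout_rhs y0 y1 j i.
Proof. by rewrite /bezout_rhs mxHD !mxHM !mxHK addrC. Qed.

Lemma bezout_sum (y0 y1 : nat -> M) i j : bezout y0 y1 i j =
  \sum_(l < j.+1) (-1) ^+ l *: bezout_rhs y0 y1 (i + l).+1 (j - l).
Proof.
elim: j i => [|j IH] i; first by rewrite big_ord1 expr0 scale1r addn0 subn0.
rewrite big_ord_recl expr0 scale1r addn0 subn0 /= IH; congr (_ + _).
rewrite -sumrN; apply: eq_bigr => l _.
by rewrite exprS mulN1r scaleNr addSn addnS.
Qed.

Variables (n : nat) (y0 y1 : nat -> M).
Hypothesis v0 : vanishes_from n.+1 y0.
Hypothesis v1 : vanishes_from n y1.
Hypothesis par0 : forall i, odd (n + i) -> y0 i = 0.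
Hypothesis par1 : forall i, ~~ odd (n + i) -> y1 i = 0.
Hypothesis lead : y0 n = 1%:M.
Hypothesis sym : forall d, \sum_(i < d.+1)
  (mxH (y0 i) *m y1 (d - i)%N - mxH (y1 i) *m y0 (d - i)%N) = 0.
Let B := bezout y0 y1.

(** This is divisibility by [u + v]: the right side of the Bezout identity vanishes at [u = -v]. By
    parity the alternating signs become, up to [(-1)^n], the relative sign of the two products in
    [sym]. *)
Let B0j j : B 0%N j = bezout_rhs y0 y1 0 j.+1.
Proof.
have : \sum_(l < j.+2) (-1) ^+ l *: bezout_rhs y0 y1 l (j.+1 - l) = 0.
  transitivity ((-1) ^+ n *: \sum_(i < j.+2)
    (mxH (y0 i) *m y1 (j.+1 - i)%N - mxH (y1 i) *m y0 (j.+1 - i)%N)); last first.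
    by rewrite sym scaler0.
  rewrite scaler_sumr; apply: eq_bigr => l _; rewrite /bezout_rhs scalerDr scalerBr.
  have sgn (a : bool) (k : nat) : odd (n + k) = a ->
      (-1) ^+ k = (-1) ^+ a * (-1) ^+ n :> C.
    move=> <-; rewrite -[in LHS]signr_odd -[in X in _ * X]signr_odd oddD.
    by do 2 case: odd; rewrite ?expr0 ?expr1 ?mul1r ?mulr1 ?mulrNN ?mulr1.
  case E: (odd (n + l)).
    by rewrite (par0 E) mxH0 !mul0mx !scaler0 !add0r (sgn _ _ E) /= expr1 mulN1r scaleNr.
  by rewrite (par1 (negbT E)) mxH0 !mul0mx !scaler0 subr0 addr0 (sgn _ _ E) /= expr0 mul1r.
rewrite big_ord_recl expr0 scale1r subn0 => /eqP; rewrite addr_eq0 => /eqP ->.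
rewrite -sumrN /B bezout_sum; apply: eq_bigr => l _.
by rewrite exprS mulN1r scaleNr opprK add0n.
Qed.

(** Started from [B0j], the identity can also be solved row by row, and this mirrors the recursion
    that defines [bezout]. *)
Let B_herm i j : mxH (B j i) = B i j.
Proof.
elim: j i => [|j IH] i; first by rewrite B0j bezout_rhs_herm.
have -> : B j.+1 i = bezout_rhs y0 y1 j.+1 i.+1 - B j i.+1 by rewrite /B /= opprB addrC subrK.
by rewrite mxHB bezout_rhs_herm IH.
Qed.

Let B_l i j : (n <= i)%N -> B i j = 0.
Proof.
have rhs0 k m : (n <= k)%N -> bezout_rhs y0 y1 k.+1 m = 0.
  by move=> nk; rewrite /bezout_rhs [y0 k.+1]v0 ?[y1 k.+1]v1 ?(leqW nk) // mxH0 !mul0mx addr0.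
elim: j i => [|j IH] i ni; first exact: rhs0.
by rewrite [LHS](_ : _ = bezout_rhs y0 y1 i.+1 j.+1 - B i.+1 j) // rhs0 // IH ?subr0 // leqW.
Qed.

Let B_r i j : (n <= j)%N -> B i j = 0.
Proof. by move=> nj; rewrite -B_herm B_l // mxH0. Qed.

Lemma bezoutP : bezout_pair n y0 y1 (bezout y0 y1).
Proof.
split=> //; first by rewrite lead unitmx1.
rewrite -/B => -[|i] [|j]; rewrite /bezout_lhs ?add0r ?addr0 ?B0j //.
  (* For the constant coefficient, parity makes one of [y0 0] and [y1 0] vanish. *)
  have [o|o] := boolP (odd (n + 0)).
    by rewrite /bezout_rhs par0 // mxH0 mul0mx mulmx0 addr0.
  by rewrite /bezout_rhs par1 // mxH0 mul0mx mulmx0 addr0.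
by rewrite /B /= subrK.
Qed.

Section Dissipation.
Variable x : nat -> 'cV[C]_p.
Let Yx (y : nat -> M) := \sum_(i < n.+1) y i *m x i.

(** The Bezout identity evaluated on a sequence, with [u] and [v] acting as the shift on the left
    and right arguments. *)
Lemma bezout_shift_form :
  \sum_(i < n) \sum_(j < n) ip (x i) (B i j *m x j.+1) +
  \sum_(i < n) \sum_(j < n) ip (x i.+1) (B i j *m x j) =
  ip (Yx y0) (Yx y1) + ip (Yx y1) (Yx y0).
Proof.
have dbl y y' : ip (Yx y) (Yx y') =
    \sum_(i < n.+1) \sum_(j < n.+1) ip (x i) (mxH (y i) *m y' j *m x j).
  rewrite /ip mxH_sum mulmx_suml summxE; apply: eq_bigr => i _.
  rewrite mulmx_sumr summxE; apply: eq_bigr => j _.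
  by rewrite mxHM !mulmxA.
rewrite !dbl -[RHS]big_split /=.
transitivity (\sum_(i < n.+1) \sum_(j < n.+1) ip (x i) (bezout_lhs B i j *m x j)).
  under [RHS]eq_bigr => i _.
    under eq_bigr => j _ do rewrite /bezout_lhs mulmxDl ipDr.
    rewrite big_split /=; over.
  rewrite big_split /= [RHS]addrC; congr (_ + _); last first.
    rewrite big_ord_recl /= [X in _ = X + _]big1 ?add0r => [|j _]; last first.
      by rewrite mul0mx ip0r.
    by apply: eq_bigr => i _; rewrite big_ord_recr /= B_r // mul0mx ip0r addr0.
  rewrite big_ord_recr /= [X in _ = _ + X]big1 ?addr0 => [|j _]; last first.
    by case: (nat_of_ord j) => [|k]; rewrite ?B_l // mul0mx ip0r.
  by apply: eq_bigr => i _; rewrite big_ord_recl /= mul0mx ip0r add0r.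
apply: eq_bigr => i _; rewrite -big_split; apply: eq_bigr => j _ /=.
by rewrite -(bezout_eq bezoutP) mulmxDl ipDr.
Qed.

End Dissipation.

Lemma mpeval_parity (b : bool) (y : nat -> M) z :
  (forall i, odd (n + i) = b -> y i = 0) ->
  mpeval n.+1 y (- z) = (-1) ^+ (n + ~~ b) *: mpeval n.+1 y z.
Proof.
move=> yb; rewrite /mpeval scaler_sumr; apply: eq_bigr => i _.
case E: (odd (n + i) == b); first by rewrite yb ?(eqP E) // !scaler0.
have -> : (-1) ^+ (n + ~~ b) = (-1) ^+ i :> C.
  rewrite -signr_odd -[RHS]signr_odd; congr (_ ^+ nat_of_bool _).
  by move: E; rewrite !oddD; case: b {yb}; do 2 case: odd.
by rewrite scalerA (exprNn z).
Qed.


Section Positivity.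
Hypothesis stable : forall z (v : 'cV[C]_p), v != 0 ->
  (mpeval n.+1 y0 z + mpeval n.+1 y1 z) *m v = 0 -> 'Re z < 0.

(* A state [X] lists the first [n] terms of a solution of the recurrence
   [\sum_(i <= n) (y0 i + y1 i) x_i = 0]; [next_state] shifts it by one step. *)
Definition block (X : 'M[C]_(p, n)) j : 'cV[C]_p :=
  if insub j is Some k then col k X else 0.

Definition solution (X : 'M[C]_(p, n)) j : 'cV[C]_p :=
  if (j < n)%N then block X j else - \sum_(i < n) (y0 i + y1 i) *m block X i.

Definition next_state (X : 'M[C]_(p, n)) : 'M[C]_(p, n) :=
  \matrix_(a, j) solution X j.+1 a 0.

Let block_linear a X Z j : block (a *: X + Z) j = a *: block X j + block Z j.
Proof.
rewrite /block; case: insubP => [k _ _|_]; last by rewrite scaler0 addr0.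
by apply/matrixP=> b e; rewrite !mxE.
Qed.

Let solution_linear a X Z j :
  solution (a *: X + Z) j = a *: solution X j + solution Z j.
Proof.
rewrite /solution; case: ltnP => _; first exact: block_linear.
rewrite scalerN -opprD scaler_sumr -big_split /=; congr (- _).
by apply: eq_bigr => i _; rewrite block_linear mulmxDr scalemxAr.
Qed.

Let next_state_linear : linear next_state.
Proof.
move=> a X Z; apply/matrixP=> b j.
by rewrite mxE solution_linear !mxE.
Qed.

Let blockE X (j : 'I_n) : block X j = col j X.
Proof. by rewrite /block valK. Qed.

Let block_next X (j : nat) : (j < n)%N -> block (next_state X) j = solution X j.+1.
Proof.
move=> jn; rewrite -[j]/(nat_of_ord (Ordinal jn)) blockE.
by apply/matrixP=> b e; rewrite !mxE ord1.
Qed.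

Let block_eq0 X : (forall j, (j < n)%N -> block X j = 0) -> X = 0.
Proof.
move=> X0; apply/matrixP=> b j; have := X0 j (ltn_ord j).
by rewrite blockE => /matrixP/(_ b 0); rewrite !mxE.
Qed.

Let solution_lt X j : (j < n)%N -> solution X j = block X j.
Proof. by rewrite /solution => ->. Qed.

(** States are flattened to row vectors for [lyapunov]. The arguments are swapped because [ip] is
    conjugate-linear on the left. *)
Let state_form (u w : 'rV[C]_(p * n)) : C :=
  \sum_(i < n) \sum_(j < n)
    ip (block (vec_mx w) i) (B i j *m block (vec_mx u) j).

Let state_form_hermitian : hermitian_form state_form.
Proof.
split=> [a u v w|u w]; rewrite /state_form.
  rewrite mulr_sumr -big_split; apply: eq_bigr => i _ /=.
  rewrite mulr_sumr -big_split; apply: eq_bigr => j _ /=.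
  by rewrite linearP block_linear mulmxDr ipDr -scalemxAr ipZr.
rewrite rmorph_sum exchange_big; apply: eq_bigr => i _ /=.
rewrite rmorph_sum; apply: eq_bigr => j _ /=.
by rewrite -ipC ip_mxH B_herm.
Qed.

Let residual X (y : nat -> M) := \sum_(i < n.+1) y i *m solution X i.

Let residual_opp X : residual X y0 = - residual X y1.
Proof.
apply/eqP; rewrite -addr_eq0 /residual -big_split big_ord_recr /=.
rewrite lead v1 // mul0mx addr0 mul1mx.
rewrite [solution X n]/solution ltnn subr_eq0; apply/eqP.
by apply: eq_bigr => i _; rewrite mulmxDl solution_lt.
Qed.

(** The recurrence says [Y_0 x = - Y_1 x], so both products in [bezout_shift_form] become
    [- |Y_1 x|^2]. *)
Let dissipation X : let u := mxvec X in let w := mxvec (next_state X) in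
  state_form w u + state_form u w = - 2 * ip (residual X y1) (residual X y1).
Proof.
have E := bezout_shift_form (solution X).
have ipNl r : ip (- r) r = - ip r r :> C by rewrite ipC ipNr rmorphN /= -ipC.
rewrite -/(residual X y0) -/(residual X y1) residual_opp ipNl ipNr in E.
rewrite /= /state_form !mxvecK mulNr mulr_natl mulr2n opprD -E.
by congr (_ + _); apply: eq_bigr => i _; apply: eq_bigr => j _;
  rewrite block_next // ?(solution_lt _ (ltn_ord i)) ?(solution_lt _ (ltn_ord j)).
Qed.

(** An eigenvector of the shift is a geometric sequence [l^j v], with [v] its first block. *)
Let eigenstate X l : X != 0 -> next_state X = l *: X ->
  exists2 v, v != 0 & forall y, residual X y = mpeval n.+1 y l *m v.
Proof.
move=> X0 EX; exists (block X 0).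
  apply: contraNneq X0 => b0; apply/eqP/block_eq0; elim=> [|j IH] jn //.
  rewrite -solution_lt // -block_next ?(ltnW jn) // EX -[_ *: _]addr0 block_linear.
  rewrite IH ?(ltnW jn) // scaler0 add0r /block.
  by case: insubP => // k _ _; apply/matrixP=> a b; rewrite !mxE.
have block0 j : block 0 j = 0.
  rewrite /block; case: insubP => // k _ _; by apply/matrixP=> a b; rewrite !mxE.
have sol j : (j <= n)%N -> solution X j = l ^+ j *: block X 0.
  elim: j => [|j IH] jn.
    rewrite expr0 scale1r /solution; case: posnP => // n0.
    case/eqP: X0; apply: block_eq0 => j; by rewrite n0.
  rewrite -block_next // EX -[_ *: _]addr0 block_linear block0 addr0.
  by rewrite -solution_lt // IH ?(ltnW jn) // scalerA exprS.
move=> y; rewrite /residual /mpeval mulmx_suml; apply: eq_bigr => i _.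
by rewrite sol -1?ltnS // -scalemxAr scalemxAl.
Qed.

(** Apply [lyapunov] to [next_state]: its eigenvalues are roots of [det F], and at an eigenvector
    the dissipation is strict. *)
Lemma bezout_positive : positive_pair n y0 y1 (bezout y0 y1).
Proof.
split=> [|x [k kn xk]]; first exact: bezoutP.
pose S := lin_mx (HB.pack_for {linear 'M[C]_(p, n) -> 'M[C]_(p, n)} next_state
  (GRing.isLinear.Build _ _ _ _ _ next_state_linear)).
have uS u : u *m S = mxvec (next_state (vec_mx u)).
  by rewrite -[u in LHS]vec_mxK mul_vec_lin.
have dis u : state_form (u *m S) u + state_form u (u *m S) =
    - 2 * ip (residual (vec_mx u) y1) (residual (vec_mx u) y1).
  by rewrite uS -[X in state_form _ X + state_form X _]vec_mxK; apply: dissipation.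
have pos := @lyapunov _ _ S _ state_form_hermitian.
have {pos} : forall u, u != 0 -> 0 < state_form u u.
  apply: pos => [u|u l u0 uSl].
    by rewrite dis mulNr oppr_le0 mulr_ge0 ?ip_ge0.
  have X0 : vec_mx u != 0.
    by apply: contraNneq u0 => X0; rewrite -[u]vec_mxK X0 linear0.
  have EX : next_state (vec_mx u) = l *: vec_mx u.
    by rewrite -[LHS]mxvecK -uS uSl linearZ.
  have [v nv resE] := eigenstate X0 EX.
  have Fv : (mpeval n.+1 y0 l + mpeval n.+1 y1 l) *m v = 0.
    by rewrite mulmxDl -!resE residual_opp addNr.
  have rl := stable nv Fv; split=> //.
  (* Otherwise [Y_0(l) v = Y_1(l) v = 0], and by parity [F(-l) v = 0] as well; but [l] and [-l]
     cannot both have negative real part. *)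
  have r1 : residual (vec_mx u) y1 != 0.
    apply: contraTneq rl => r1; rewrite -real_leNgt ?Creal_Re ?real0 //.
    have r0 : residual (vec_mx u) y0 = 0 by rewrite residual_opp r1 oppr0.
    rewrite -oppr_le0 -raddfN ltW //; apply: (stable nv).
    rewrite (mpeval_parity (b := true)) // (mpeval_parity (b := false)); last first.
      by move=> i /negbT; apply: par1.
    by rewrite mulmxDl -!scalemxAl -!resE r0 r1 !scaler0 addr0.
  have : state_form (u *m S) u + state_form u (u *m S) < 0.
    by rewrite dis mulNr oppr_lt0 mulr_gt0 ?ltr0n // lt_def ip_ge0 ip_eq0 r1.
  rewrite uSl (hformZl state_form_hermitian) (hformZr state_form_hermitian).
  have -> : l * state_form u u + l^* * state_form u u = 2 * 'Re l * state_form u u.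
    by rewrite ReE; field.
  by rewrite nmulr_rlt0 // pmulr_rlt0 ?ltr0n.
pose X : 'M[C]_(p, n) := \matrix_(a, j) x j a 0.
have bX j : (j < n)%N -> block X j = x j.
  move=> jn; rewrite -[j]/(nat_of_ord (Ordinal jn)) blockE.
  by apply/matrixP=> b e; rewrite !mxE ord1.
move=> /(_ (mxvec X)); rewrite /state_form mxvecK => pos.
have -> : quad_form n (bezout y0 y1) x =
    \sum_(i < n) \sum_(j < n) ip (block X i) (B i j *m block X j).
  by apply: eq_bigr => i _; apply: eq_bigr => j _; rewrite !bX.
apply: pos; apply: contraNneq xk => X0.
by rewrite -bX // -[X]mxvecK X0 linear0 /block; case: insubP => // j _ _;
  apply/eqP/matrixP=> a b; rewrite !mxE.
Qed.

End Positivity.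

End BezoutianOfStable.

(** * Remainder estimates, and symmetry from Hermitian Markov parameters *)

Section MarkovSymmetry.
Variables (R : realType).
Local Notation C := (complex R).

(** Convergence at the single point [w0] bounds the coefficients geometrically; for [|w| > 2 w0] the
    tail is dominated by a geometric series of ratio at most one half. *)
Lemma laurent_tail (a : nat -> C) (g : C -> C) n :
  for_large (fun w => forall eps : C, 0 < eps -> exists N, forall K, (N <= K)%N ->
    `|\sum_(k < K) a k * w ^- k - g w| < eps) ->
  exists2 B, 0 <= B &
    for_large (fun w => `|g w - \sum_(k < n) a k * w ^- k| <= B * `|w| ^- n).
Proof.
move=> /for_largeE[r r0 cvg]; pose w0 := r + 1.
have w00 : 0 < w0 by rewrite addr_gt0.
have nw0 : `|w0| = w0 by rewrite ger0_norm // ltW.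
have [N NK] : exists N, forall K, (N <= K)%N ->
    `|\sum_(k < K) a k * w0 ^- k - g w0| < 1.
  by apply: cvg => //; rewrite nw0 ltrDl.
(* The [2] covers the terms from [N] on, each a difference of partial sums within [1] of the limit;
   the sum covers the earlier terms. *)
pose B0 := 2 + \sum_(k < N) `|a k| * w0 ^- k.
have B00 : 0 <= B0.
  by rewrite addr_ge0 // sumr_ge0 // => k _; rewrite mulr_ge0 // invr_ge0 exprn_ge0 // ltW.
have aB k : `|a k| <= B0 * w0 ^+ k.
  have wk : 0 < w0 ^+ k by rewrite exprn_gt0.
  rewrite -ler_pdivrMr // /B0.
  have [kN|kN] := ltnP k N.
    rewrite (bigD1 (Ordinal kN)) //= addrCA lerDl addr_ge0 // sumr_ge0 // => i _.
    by rewrite mulr_ge0 // invr_ge0 exprn_ge0 // ltW.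
  have -> : `|a k| / w0 ^+ k = `|a k * w0 ^- k|.
    by rewrite normrM normrV ?unitfE ?gt_eqF // normrX nw0.
  have -> : a k * w0 ^- k = (\sum_(i < k.+1) a i * w0 ^- i - g w0) -
                          (\sum_(i < k) a i * w0 ^- i - g w0).
    by rewrite big_ord_recr /=; ring.
  apply: le_trans (ler_normB _ _) _.
  apply: le_trans (lerD (ltW (NK _ _)) (ltW (NK _ _))) _ => //.
    exact: leqW.
  rewrite -[1 + 1]/(2 : C) lerDl sumr_ge0 // => i _.
  by rewrite mulr_ge0 // invr_ge0 exprn_ge0 // ltW.
exists ((2 * B0 + 1) * w0 ^+ n).
  by rewrite mulr_ge0 ?exprn_ge0 ?addr_ge0 ?mulr_ge0 // ltW.
apply: (@for_largeI _ (2 * w0)) => [|w ww]; first by rewrite mulr_ge0 // ltW.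
have wpos : 0 < `|w| by rewrite (lt_trans _ ww) // mulr_gt0.
have rw : r < `|w|.
  by rewrite (lt_trans _ ww) // mulr_natl mulr2n ltr_wpDr ?ltW // /w0 ltrDl.
pose q := w0 / `|w|.
have q0 : 0 < q by rewrite divr_gt0.
have q2 : 2 * q <= 1 by rewrite /q mulrA ler_pdivrMr // mul1r ltW.
have term k : `|a k * w ^- k| <= B0 * q ^+ k.
  rewrite normrM normfV normrX /q expr_div_n mulrA ler_wpM2r //.
  by rewrite invr_ge0 exprn_ge0.
(* Adding the bound for the rest of the geometric series makes the estimate inductive, since
   [2 q <= 1]. *)
have tail m : `|\sum_(k < n + m) a k * w ^- k - \sum_(k < n) a k * w ^- k|
    + 2 * B0 * q ^+ (n + m) <= 2 * B0 * q ^+ n.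
  elim: m => [|m IH]; first by rewrite addn0 subrr normr0 add0r.
  apply: le_trans IH; rewrite addnS big_ord_recr /= -addrAC.
  apply: le_trans (lerD (ler_normD _ _) (lexx _)) _; rewrite -addrA lerD2l.
  apply: le_trans (lerD (term _) (lexx _)) _.
  rewrite exprS -[2 * B0 * q ^+ _]mulrA [2 * (B0 * _)]mulr_natl mulr2n lerD2l.
  have -> : 2 * B0 * (q * q ^+ (n + m)) = 2 * q * (B0 * q ^+ (n + m)) by ring.
  by rewrite ler_piMl // mulr_ge0 // exprn_ge0 // ltW.
(* The precision [q ^+ n] accounts for the [+ 1] in the constant. *)
have [N' N'K] := cvg w rw (q ^+ n) (exprn_gt0 n q0).
have {N'K} gN := N'K (n + N')%N (leq_addl _ _).
have -> : (2 * B0 + 1) * w0 ^+ n * `|w| ^- n = 2 * B0 * q ^+ n + q ^+ n.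
  by rewrite -mulrA -expr_div_n -/q mulrDl mul1r.
have -> : g w - \sum_(k < n) a k * w ^- k =
   (\sum_(k < n + N') a k * w ^- k - \sum_(k < n) a k * w ^- k) -
   (\sum_(k < n + N') a k * w ^- k - g w) by ring.
apply: le_trans (ler_normB _ _) _; apply: lerD (ltW gN).
apply: le_trans (tail N'); rewrite lerDl mulr_ge0 ?mulr_ge0 //.
by rewrite exprn_ge0 // ltW.
Qed.

Lemma poly_decay_eq0 (q : {poly C}) (r B : C) : 0 <= r -> 0 <= B ->
  (forall t, r < t -> `|t * q.[t]| <= B) -> q = 0.
Proof.
move=> r0 B0 bnd; apply/eqP; apply: contraT => q0.
have [d sz] : exists d, size q = d.+1.
  by exists (size q).-1; rewrite prednK // lt0n size_poly_eq0.
have lc : 0 < `|q`_d|.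
  by rewrite normr_gt0; move: q0; rewrite -lead_coef_eq0 lead_coefE sz.
pose S := \sum_(i < d) `|q`_i|; have S0 : 0 <= S by exact: sumr_ge0.
(* Beyond [r] and [1], this [t] strictly exceeds [(B + S) / |q_d|], so the leading term outweighs
   the bound [B] and all lower terms. *)
pose t := 1 + r + (B + S) / `|q`_d|.
have BS : 0 <= (B + S) / `|q`_d| by rewrite divr_ge0 // addr_ge0.
have t1 : 1 <= t by rewrite /t -addrA lerDl addr_ge0.
have tr : r < t.
  by rewrite /t -addrA addrCA ltrDl ltr_wpDr.
have t0 : 0 < t by apply: lt_le_trans t1.
have tn : `|t| = t by rewrite ger0_norm // ltW.
have := bnd t tr; rewrite horner_coef sz big_ord_recr /= => le.
have : `|q`_d| * t ^+ d.+1 <= (B + S) * t ^+ d.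
  have -> : `|q`_d| * t ^+ d.+1 = `|t * (q`_d * t ^+ d)|.
    by rewrite !normrM normrX tn exprS mulrCA.
  have -> : t * (q`_d * t ^+ d) = t * (\sum_(i < d) q`_i * t ^+ i + q`_d * t ^+ d) -
      t * (\sum_(i < d) q`_i * t ^+ i) by ring.
  apply: le_trans (ler_normB _ _) _; rewrite [(B + S) * _]mulrDl; apply: lerD.
    by apply: le_trans le _; rewrite ler_peMr // exprn_ege1.
  rewrite normrM tn mulr_suml.
  apply: le_trans (ler_wpM2l (ltW t0) (ler_norm_sum _ _ _)) _.
  rewrite mulr_sumr; apply: ler_sum => i _; rewrite normrM normrX tn mulrCA -exprS.
  by rewrite ler_wpM2l // ler_weXn2l.
rewrite exprS mulrA ler_pM2r ?exprn_gt0 // mulrC -ler_pdivlMr //.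
by rewrite /t gerDr => /(lt_le_trans _); move=> /(_ 0); rewrite ltr_wpDr // ltxx => /(_ isT).
Qed.

Variable p : nat.
Local Notation M := 'M[C]_p.

(** Let [E] be [t Y_1 Y_0^{-1}] minus its Hermitian truncation. Then [t (Y_0^* Y_1 - Y_1^* Y_0) =
    Y_0^* (E - E^* ) Y_0] for large real [t]. It stays bounded, as [Y_0] grows at most like [t^n]
    and [E] decays like [t^(-2n)], so [poly_decay_eq0] applies to each entry. *)
Lemma markov_symmetry n (y0 y1 s : nat -> M) (B : C) :
    vanishes_from n.+1 y0 -> vanishes_from n.+1 y1 -> y0 n \in unitmx ->
    (forall k, (k < n)%N -> is_hermitian (s k)) -> 0 <= B ->
    for_large (fun t => forall i j,
     `|(t *: (mpeval n.+1 y1 t *m invmx (mpeval n.+1 y0 t)) -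
        \sum_(k < n) ((-1) ^+ k * t ^- k.*2) *: s k) i j| <= B * `|t| ^- n.*2) ->
  forall d, \sum_(i < d.+1)
    (mxH (y0 i) *m y1 (d - i)%N - mxH (y1 i) *m y0 (d - i)%N) = 0.
Proof.
move=> v0 v1 u0 hs B0 bnd d; apply/matrixP=> a b.
pose P (y : nat -> M) i j := \poly_(k < n.+1) y k i j.
pose PH (y : nat -> M) i j := \poly_(k < n.+1) (y k i j)^*.
have PE (y : nat -> M) i j k : vanishes_from n.+1 y -> (P y i j)`_k = y k i j.
  by move=> vy; rewrite coef_poly; case: ltnP => // /vy ->; rewrite mxE.
have PHE (y : nat -> M) i j k : vanishes_from n.+1 y -> (PH y i j)`_k = (y k i j)^*.
  by move=> vy; rewrite coef_poly; case: ltnP => // /vy ->; rewrite mxE rmorph0.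
pose q := \sum_c (PH y0 c a * P y1 c b - PH y1 c a * P y0 c b).
suff q0 : q = 0.
  have := congr1 (fun f : {poly C} => f`_d) q0; rewrite coef0 coef_sum => E.
  rewrite summxE mxE -[RHS]E.
  under [RHS]eq_bigr => c _.
    rewrite coefB !coefM -sumrB.
    under eq_bigr => i _ do rewrite !PE // !PHE //.
    over.
  rewrite exchange_big; apply: eq_bigr => i _ /=.
  rewrite mxE [X in _ + X]mxE [X in X - _]mxE [X in _ - X]mxE -sumrB.
  by apply: eq_bigr => c _; rewrite !mxHE.
have [r r0 {}bnd] := for_largeE (for_large_and bnd (mpeval_lead_unit_large u0)).
(* For [t >= 1] every entry of [Y_0(t)] has modulus at most [W t^n]. *)
pose W := \sum_(i < n.+1) \sum_a \sum_b `|y0 i a b|.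
have W0 : 0 <= W by do 3 (apply: sumr_ge0 => ? _).
apply: (@poly_decay_eq0 q (r + 1) (\sum_(i < p) \sum_(j < p) W * (B + B) * W)).
- by rewrite addr_ge0 // ltW.
- by do 2 (apply: sumr_ge0 => ? _); rewrite !mulr_ge0 // addr_ge0.
move=> t rt; have t1 : 1 <= t by rewrite ltW // (le_lt_trans _ rt) // lerDr ltW.
have t0 : 0 < t by apply: lt_le_trans t1.
have tn : `|t| = t by rewrite ger0_norm // ltW.
have tC : t^* = t by apply: conj_Creal; apply: gtr0_real.
have rtn : r < `|t| by rewrite tn (lt_trans _ rt) // ltrDl.
have [bndt ut] := bnd t rtn.
set Y0 := mpeval n.+1 y0 t in ut bndt *; set Y1 := mpeval n.+1 y1 t in bndt *.
have YW i j : `|Y0 i j| <= W * t ^+ n.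
  rewrite /Y0 /mpeval summxE; apply: le_trans (ler_norm_sum _ _ _) _.
  rewrite /W mulr_suml; apply: ler_sum => k _.
  rewrite mxE normrM normrX tn mulrC; apply: ler_pM => //; first by rewrite exprn_ge0 // ltW.
    rewrite (bigD1 i) //= (bigD1 j) //= -addrA lerDl addr_ge0 //.
      by apply: sumr_ge0 => ? _.
    by do 2 (apply: sumr_ge0 => ? _).
  by rewrite ler_weXn2l // -ltnS.
have qE : q.[t] = (mxH Y0 *m Y1 - mxH Y1 *m Y0) a b.
  have HE (y : nat -> M) i j : (PH y i j).[t] = (mpeval n.+1 y t i j)^*.
    rewrite horner_poly /mpeval summxE rmorph_sum; apply: eq_bigr => k _ /=.
    by rewrite mxE rmorphM rmorphXn /= tC mulrC.
  rewrite horner_sum mxE [X in _ + X]mxE [X in X - _]mxE [X in _ - X]mxE.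
  rewrite -sumrB; apply: eq_bigr => c _.
  by rewrite hornerD hornerN !hornerM !HE -!mpeval_entry !mxHE.
set Sn := \sum_(k < n) _ in bndt; set E := _ - Sn in bndt.
have {}bndt i j : `|E i j| <= B * t ^- n.*2 by rewrite -[t in t ^- _]tn bndt.
have SH : mxH Sn = Sn.
  rewrite /Sn mxH_sum; apply: eq_bigr => k _; rewrite mxHZ hs //.
  by rewrite rmorphM rmorphXn fmorphV rmorphXn /= rmorphN1 tC.
have GY : t *: (Y1 *m invmx Y0) *m Y0 = t *: Y1.
  by rewrite -scalemxAl -mulmxA mulVmx // mulmx1.
have GH : mxH Y0 *m mxH (t *: (Y1 *m invmx Y0)) = t *: mxH Y1.
  by rewrite -mxHM GY mxHZ tC.
have key : t *: (mxH Y0 *m Y1 - mxH Y1 *m Y0) = mxH Y0 *m (E - mxH E) *m Y0.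
  rewrite /E mxHB SH opprB addrA subrK mulmxBr mulmxBl GH -mulmxA GY.
  by rewrite -scalemxAl -scalemxAr scalerBr.
have -> : t * q.[t] = (mxH Y0 *m (E - mxH E) *m Y0) a b by rewrite qE -key [RHS]mxE.
rewrite mxE; apply: le_trans (ler_norm_sum _ _ _) _; apply: ler_sum => i _.
rewrite mxE mulr_suml; apply: le_trans (ler_norm_sum _ _ _) _; apply: ler_sum => j _.
have tnn : 0 < t ^+ n by rewrite exprn_gt0.
have -> : W * (B + B) * W = W * t ^+ n * ((B + B) * t ^- n.*2) * (W * t ^+ n).
  by rewrite -addnn exprD; field; rewrite gt_eqF.
rewrite !normrM; apply: ler_pM => //; first by rewrite mulr_ge0.
apply: ler_pM => //; first by rewrite mxHE norm_conjC.
rewrite mxE; apply: le_trans (ler_normD _ _) _; rewrite mulrDl; apply: lerD.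
  exact: bndt.
by rewrite mxE normrN mxHE norm_conjC.
Qed.

End MarkovSymmetry.

(** * Splitting by parity, and its relation to the even and odd parts *)

Section Parts.
Variables (R : realType) (p : nat).
Local Notation C := (complex R).
Local Notation M := 'M[C]_p.
Implicit Types (A s : nat -> M).

(* Coefficients of [z^i]; the parity refers to the index [n - i] of [A]. *)
Definition even_coef n A i : M :=
  if (i <= n)%N && ~~ odd (n - i) then A (n - i)%N else 0.
Definition odd_coef n A i : M :=
  if (i <= n)%N && odd (n - i) then A (n - i)%N else 0.

Lemma mxpoly_eval_parts n A z : mxpoly_eval n A z =
  mpeval n.+1 (even_coef n A) z + mpeval n.+1 (odd_coef n A) z.
Proof.
rewrite /mxpoly_eval /mpeval -big_split /= (reindex_inj rev_ord_inj) /=.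
apply: eq_bigr => i _; have iN : (i <= n)%N by rewrite -ltnS.
rewrite subSS (subKn iN) -scalerDr /even_coef /odd_coef iN /=.
by case: odd; rewrite ?addr0 ?add0r.
Qed.

Lemma sum_parity (V : nmodType) m (f : nat -> V) :
  \sum_(k < m.*2) (if odd k then 0 else f k) = \sum_(k < m) f k.*2 /\
  \sum_(k < m.*2) (if odd k then f k else 0) = \sum_(k < m) f k.*2.+1.
Proof.
elim: m => [|m [IH0 IH1]]; first by rewrite !big_ord0.
rewrite doubleS !big_ord_recr /= IH0 IH1 odd_double /=.
by rewrite !addr0.
Qed.

Lemma mpeval_even_coef n A z : mpeval n.+1 (even_coef n A) z =
  \sum_(k < n.+1) (if odd k then 0 else z ^+ (n - k) *: A k).
Proof.
rewrite /mpeval (reindex_inj rev_ord_inj) /=; apply: eq_bigr => i _.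
have iN : (i <= n)%N by rewrite -ltnS.
rewrite subSS /even_coef (subKn iN) leq_subr /=.
by case: odd; rewrite ?scaler0.
Qed.

Lemma mpeval_odd_coef n A z : mpeval n.+1 (odd_coef n A) z =
  \sum_(k < n.+1) (if odd k then z ^+ (n - k) *: A k else 0).
Proof.
rewrite /mpeval (reindex_inj rev_ord_inj) /=; apply: eq_bigr => i _.
have iN : (i <= n)%N by rewrite -ltnS.
rewrite subSS /odd_coef (subKn iN) leq_subr /=.
by case: odd; rewrite ?scaler0.
Qed.

Lemma Fe_evenE m A z :
  mpeval m.*2.+1 (even_coef m.*2 A) z = Fe_even m A (z ^+ 2).
Proof.
rewrite mpeval_even_coef big_ord_recr /= odd_double.
rewrite (sum_parity m (fun k => z ^+ (m.*2 - k) *: A k)).1.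
rewrite /Fe_even big_ord_recr /= !subnn; congr (_ + _); apply: eq_bigr => k _.
by rewrite -exprM mul2n doubleB.
Qed.

Lemma Fo_evenE m A z :
  mpeval m.*2.+1 (odd_coef m.*2 A) z = z *: Fo_even m A (z ^+ 2).
Proof.
rewrite mpeval_odd_coef big_ord_recr /= odd_double addr0.
rewrite (sum_parity m (fun k => z ^+ (m.*2 - k) *: A k)).2.
rewrite /Fo_even big_add1 big_mkord scaler_sumr; apply: eq_bigr => k _.
rewrite scalerA -exprM -exprS doubleS /=; congr (_ ^+ _ *: _).
by have := ltn_ord k; lia.
Qed.

Lemma Fo_oddE m A z :
  mpeval m.*2.+2 (even_coef m.*2.+1 A) z = z *: Fo_odd m A (z ^+ 2).
Proof.
rewrite mpeval_even_coef -doubleS.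
rewrite (sum_parity m.+1 (fun k => z ^+ (m.*2.+1 - k) *: A k)).1 scaler_sumr.
apply: eq_bigr => k _; rewrite scalerA -exprM -exprS; congr (_ ^+ _ *: _).
by have := ltn_ord k; lia.
Qed.

Lemma Fe_oddE m A z :
  mpeval m.*2.+2 (odd_coef m.*2.+1 A) z = Fe_odd m A (z ^+ 2).
Proof.
rewrite mpeval_odd_coef -doubleS (sum_parity m.+1 (fun k => z ^+ (m.*2.+1 - k) *: A k)).2.
by apply: eq_bigr => k _; rewrite -exprM mul2n doubleB subSS.
Qed.

Lemma vanishes_even_coef n A : vanishes_from n.+1 (even_coef n A).
Proof. by move=> i ni; rewrite /even_coef leqNgt ni. Qed.

Lemma vanishes_odd_coef n A : vanishes_from n (odd_coef n A).
Proof.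
move=> i ni; rewrite /odd_coef; case: ifP => // /andP[le].
by have -> : (n - i = 0)%N by lia.
Qed.

Lemma even_coef_lead n A : even_coef n A n = A 0%N.
Proof. by rewrite /even_coef leqnn subnn. Qed.

Lemma even_coef_parity n A i : odd (n + i) -> even_coef n A i = 0.
Proof.
by move=> o; rewrite /even_coef; case: leqP => //= le; rewrite oddB // -oddD o.
Qed.

Lemma odd_coef_parity n A i : ~~ odd (n + i) -> odd_coef n A i = 0.
Proof.
by move=> o; rewrite /odd_coef; case: leqP => //= le; rewrite oddB // -oddD (negbTE o).
Qed.

End Parts.

(** * Uniform remainder bounds for matrix series *)

Section MarkovSeries.
Variables (R : realType) (p : nat).
Local Notation C := (complex R).
Local Notation M := 'M[C]_p.

Lemma for_large_forall (T : finType) (P : T -> C -> Prop) :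
  (forall x, for_large (P x)) -> for_large (fun z => forall x, P x z).
Proof.
move=> /fin_all_exists[r rP]; exists (\sum_x `|r x|) => z rz x; apply: rP.
apply: le_lt_trans rz; rewrite lecR (bigD1 x) //=.
by rewrite (le_trans (ler_norm _)) // lerDl sumr_ge0.
Qed.

Lemma mx_series_to_scale a (u : nat -> M) (L : M) : a != 0 ->
  mx_series_to u L -> mx_series_to (fun k => a *: u k) (a *: L).
Proof.
move=> a0 uL i j eps eps0.
have [|N NK] := uL i j (eps / `|a|); first by rewrite divr_gt0 // normr_gt0.
exists N => K /NK; rewrite ltr_pdivlMr ?normr_gt0 // -normrM.
have sc (X : M) : (a *: X) i j = a * X i j by rewrite mxE.
by rewrite -scaler_sumr !sc -mulrBr mulrC.
Qed.

Lemma markov_tail n (s : nat -> M) (G : C -> M) :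
  for_large (fun w => mx_series_to (fun k => ((-1) ^+ k * w ^- k) *: s k) (G w)) ->
  exists2 B, 0 <= B & for_large (fun w => forall i j,
    `|(G w - \sum_(k < n) ((-1) ^+ k * w ^- k) *: s k) i j| <= B * `|w| ^- n).
Proof.
move=> ser.
have entry K w i j : (\sum_(k < K) ((-1) ^+ k * w ^- k) *: s k) i j =
    \sum_(k < K) ((-1) ^+ k * s k i j) * w ^- k.
  by rewrite summxE; apply: eq_bigr => k _; rewrite mxE mulrAC.
have tl (x : 'I_p * 'I_p) : exists B, 0 <= B /\ for_large (fun w =>
    `|(G w - \sum_(k < n) ((-1) ^+ k * w ^- k) *: s k) x.1 x.2| <= B * `|w| ^- n).
  have [|B B0 Bw] := @laurent_tail R (fun k => (-1) ^+ k * s k x.1 x.2)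
     (fun w => G w x.1 x.2) n.
    apply: for_largeW ser => w /(_ x.1 x.2) sw eps /sw[N NK].
    by exists N => K /NK; rewrite entry.
  exists B; split=> //; apply: for_largeW Bw => w.
  have sb (X Y : M) : (X - Y) x.1 x.2 = X x.1 x.2 - Y x.1 x.2 by rewrite !mxE.
  by rewrite sb entry.
have [B HB] := fin_all_exists tl.
exists (\sum_x B x); first by apply: sumr_ge0 => x _; case: (HB x).
apply: for_largeW (for_large_forall (fun x => (HB x).2)) => w Hw i j.
apply: le_trans (Hw (i, j)) _; rewrite ler_wpM2r ?invr_ge0 ?exprn_ge0 //.
rewrite (bigD1 (i, j)) //= lerDl sumr_ge0 // => x _; by case: (HB x).
Qed.

End MarkovSeries.

(** * The stability criterion and the change of variable in the fractions *)

Section Criterion.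
Variables (R : realType) (p : nat).
Local Notation C := (complex R).
Local Notation M := 'M[C]_p.

Lemma hurwitzP n (A : nat -> M) : hurwitz n A <->
  forall z (v : 'cV[C]_p), v != 0 -> mxpoly_eval n A z *m v = 0 -> 'Re z < 0.
Proof.
split=> [st z v v0 Fv | st z dF].
  apply: st; apply/eqP; apply: contraNT v0 => dF.
  have u : mxpoly_eval n A z \in unitmx by rewrite unitmxE unitfE.
  by rewrite -[v](mulKmx u) Fv mulmx0.
apply: contraT => nz.
have : mxpoly_eval n A z \in unitmx.
  apply: unitmx_injP => v Fv; apply/eqP; apply: contraNT nz => v0.
  exact: st v0 Fv.
by rewrite unitmxE dF unitr0.
Qed.

(** [G] unifies the two kinds of Markov parameters. Stability yields in turn the symmetry, the
    positive Bezoutian and the descent; the converse is [fraction_expansion_stable]. *)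
Lemma hurwitz_fraction_expansion n (A s : nat -> M) (G : C -> M) :
    (0 < n)%N -> A 0%N = 1%:M -> (forall k, (k < n)%N -> is_hermitian (s k)) ->
    for_large (fun w => mx_series_to (fun k => ((-1) ^+ k * w ^- k) *: s k) (G w)) ->
    for_large (fun z => z *: (mpeval n.+1 (odd_coef n A) z *m
                  invmx (mpeval n.+1 (even_coef n A) z)) = G (z ^+ 2)) ->
  (hurwitz n A <-> exists c, all_posdef n c /\
     fraction_expansion n c (even_coef n A) (odd_coef n A)).
Proof.
move=> n0 A0 hs ser Gz.
have v0 := @vanishes_even_coef R p n A; have v1 := @vanishes_odd_coef R p n A.
have w1 : vanishes_from n.+1 (odd_coef n A) by move=> i ni; apply/v1/ltnW.
have lead : even_coef n A n = 1%:M by rewrite even_coef_lead.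
have u0 : even_coef n A n \in unitmx by rewrite lead unitmx1.
split=> [/hurwitzP st | [c [pc ec]]].
  case: n n0 hs Gz st v0 v1 w1 lead u0 => // n _ hs Gz st v0 v1 w1 lead u0.
  apply: (@positive_pair_expansion _ _ _ _ _
    (bezout (even_coef n.+1 A) (odd_coef n.+1 A))).
  have [B B0 Bw] := markov_tail n.+1 ser.
  apply: bezout_positive => //.
  - exact: even_coef_parity.
  - exact: odd_coef_parity.
  - apply: (markov_symmetry v0 w1 u0 hs B0).
    apply: for_largeW (for_large_and Gz (for_large_sqr Bw)) => t [-> Bt] i j.
    have := Bt i j; rewrite -normrX -exprM mul2n normrX.
    by under [in X in X -> _]eq_bigr => k _ do rewrite -exprM mul2n.
  - by move=> z v nv; rewrite -mxpoly_eval_parts; apply: st.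
apply/hurwitzP => z v nv; rewrite mxpoly_eval_parts.
exact: (fraction_expansion_stable n0 v0 w1 ec pc u0 nv).
Qed.

Definition scale_factor (zf : nat -> bool) (z : C) j := if zf j then z else z^-1.

(** The factors [z] and [z^-1] alternate and are mutually inverse, so the scaling passes through
    each inversion. Invertibility may be known on either side, which lets both directions of
    [Rcf_Tfrac] use this. *)
Lemma Rrec_Tfrac zf (c : nat -> M) z k j :
    (forall i, zf i.+1 = ~~ zf i) -> z != 0 -> zf (j + k)%N ->
    c (j + k).+1 \in unitmx ->
    (forall i, (i < k)%N -> Rrec zf c (z ^+ 2) i (j + k - i) \in unitmx \/
                            Tfrac c z i.+1 (j + k - i) \in unitmx) ->
  Rrec zf c (z ^+ 2) k j = scale_factor zf z j *: Tfrac c z k.+1 j.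
Proof.
move=> alt z0; elim: k j => [|k IH] j zk ck un.
  rewrite addn0 in zk ck; rewrite /scale_factor zk /= scalerDr scalerA -expr2.
  by rewrite invmxZ ?scalerA ?mulfV ?scale1r // unitmxZ ?unitfE.
have IHj : Rrec zf c (z ^+ 2) k j.+1 = scale_factor zf z j.+1 *: Tfrac c z k.+1 j.+1.
  by apply: IH => [||i ik]; rewrite ?addSnnS //; apply: un; apply: leqW.
have sc0 i : scale_factor zf z i != 0.
  by rewrite /scale_factor; case: ifP; rewrite ?invr_eq0.
have uT : Tfrac c z k.+1 j.+1 \in unitmx.
  have := un k (ltnSn k); have -> : (j + k.+1 - k = j.+1)%N by lia.
  by rewrite IHj unitmxZ ?unitfE //; case.
rewrite [LHS]/= IHj invmxZ ?unitmxZ ?unitfE // [Tfrac c z k.+2 j]/= scalerDr.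
congr (_ + _ *: _); rewrite /dterm /scale_factor ?alt; case: (zf j) => /=;
  by rewrite ?scalerA ?expr2 ?mulVf ?scale1r ?invrK.
Qed.

Lemma Rcf_Tfrac n zf (c : nat -> M) z :
    (1 < n)%N -> (forall i, zf i.+1 = ~~ zf i) -> zf n.-1 -> z != 0 ->
    all_posdef n c ->
  (Rcf_invertible n zf c (z ^+ 2) <->
     forall j, (1 <= j <= n)%N -> Tfrac c z (n - j) j \in unitmx) /\
  (Rcf_invertible n zf c (z ^+ 2) ->
     Rcf n zf c (z ^+ 2) 1 = scale_factor zf z 1 *: Tfrac c z n.-1 1).
Proof.
move=> n1 alt zn z0 pc.
have cn : c n \in unitmx by apply/posdef_unit/pc; lia.
have sc0 i : scale_factor zf z i != 0.
  by rewrite /scale_factor; case: ifP; rewrite ?invr_eq0.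
have RT j : (1 <= j <= n.-1)%N ->
    (forall i, (j < i <= n.-1)%N -> Rcf n zf c (z ^+ 2) i \in unitmx \/
       Tfrac c z (n - i) i \in unitmx) ->
    Rcf n zf c (z ^+ 2) j = scale_factor zf z j *: Tfrac c z (n - j) j.
  move=> jn un; have -> : (n - j = (n.-1 - j).+1)%N by lia.
  have jE : (j + (n.-1 - j) = n.-1)%N by lia.
  apply: Rrec_Tfrac; rewrite ?jE ?prednK // 1?ltnW // => i ij.
  have [|u|u] := un (n.-1 - i)%N; [lia|left|right].
    by move: u; rewrite /Rcf; have -> : (n.-1 - (n.-1 - i) = i)%N by lia.
  by move: u; have -> : (n - (n.-1 - i) = i.+1)%N by lia.
split; last first.
  by move=> un; rewrite RT ?subn1 // => [|i ij]; [lia|left; apply: un; lia].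
split=> un j jn.
  have [jn1|jn1] := leqP j n.-1; last first.
    (* [Rcf_invertible] stops at [n - 1]; the last tail [T_n = z c_n] is invertible since [c_n]
       is. *)
    have -> : j = n by lia.
    by rewrite subnn /= unitmxZ ?unitfE.
  have := un j; rewrite RT => [|//|i ij]; [|lia|left; apply: un; lia].
  by rewrite unitmxZ ?unitfE //; apply; lia.
rewrite RT // => [|i ij]; last by right; apply: un; lia.
by rewrite unitmxZ ?unitfE //; apply: un; lia.
Qed.

(* [P = F_o, Q = F_e] for even degree and [P = F_e, Q = F_o] for odd degree. *)
Lemma fraction_expansion_Rcf n zf (c : nat -> M) y0 y1 (P Q : C -> M) :
    (1 < n)%N -> (forall i, zf i.+1 = ~~ zf i) -> zf n.-1 -> all_posdef n c ->
    (forall z, z != 0 -> exists2 a, a != 0 & mpeval n.+1 y0 z = a *: Q (z ^+ 2) /\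
       mpeval n.+1 y1 z = (a * scale_factor zf z 1) *: P (z ^+ 2)) ->
  fraction_expansion n c y0 y1 <-> for_large (fun w =>
    Rcf_invertible n zf c w /\ Q w = Rcf n zf c w 1 *m P w).
Proof.
move=> n1 alt zn pc PQ.
have E z : z != 0 ->
    ((forall j, (1 <= j <= n)%N -> Tfrac c z (n - j) j \in unitmx) /\
     mpeval n.+1 y0 z = Tfrac c z n.-1 1 *m mpeval n.+1 y1 z) <->
    (Rcf_invertible n zf c (z ^+ 2) /\
     Q (z ^+ 2) = Rcf n zf c (z ^+ 2) 1 *m P (z ^+ 2)).
  move=> z0; have [uRT RT] := Rcf_Tfrac n1 alt zn z0 pc.
  have [a a0 [-> ->]] := PQ z z0.
  rewrite -scalemxAr -scalerA scalemxAl.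
  split=> [[/uRT uR QP]|[uR QP]]; split=> //; try exact/uRT.
    by apply: (scalerI a0); rewrite RT.
  by rewrite QP RT.
split=> ex.
  apply: for_large_sqrt; apply: for_largeW (for_large_and ex (@for_large_neq0 R)).
  by move=> z [H z0]; apply/(E z z0).
apply: for_largeW (for_large_and (for_large_sqr ex) (@for_large_neq0 R)).
by move=> z [H z0]; apply/(E z z0).
Qed.

End Criterion.

(** * Quotient forms and the two degree parities *)

Section Quotients.
Variables (R : realType) (p : nat).
Local Notation C := (complex R).
Local Notation M := 'M[C]_p.

Lemma eq_mx_series_to (u v : nat -> M) L :
  (forall k, u k = v k) -> mx_series_to u L -> mx_series_to v L.
Proof.
move=> uv uL i j eps eps0; have [N NK] := uL i j eps eps0; exists N => K /NK.
by under eq_bigr => k _ do rewrite uv.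
Qed.

(** With [Q] and [R_1] invertible, [Q = R_1 P] and [P Q^{-1} = R_1^{-1}] are the same equation. *)
Lemma for_large_quotient n zf (c : nat -> M) (P Q : C -> M) : (1 < n)%N ->
    for_large (fun w => Q w \in unitmx) ->
  for_large (fun w => Rcf_invertible n zf c w /\ Q w = Rcf n zf c w 1 *m P w) <->
  for_large (fun w => Rcf_invertible n zf c w /\
                      P w *m invmx (Q w) = invmx (Rcf n zf c w 1)).
Proof.
move=> n1 uQ; split=> ex; apply: for_largeW (for_large_and uQ ex);
  move=> w [uQw [uR E]]; split=> //.
all: have u1 : Rcf n zf c w 1 \in unitmx by apply: uR; lia.
  by apply: (can_inj (mulKmx u1)); rewrite mulmxA -E !mulmxV.
by rewrite -[P w](mulmxKV uQw) E mulKVmx.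
Qed.

Variables (m : nat) (A : nat -> M).
Hypothesis A0 : A 0%N = 1%:M.

Lemma Fe_even_large : for_large (fun w => Fe_even m A w \in unitmx).
Proof.
have u0 : even_coef m.*2 A m.*2 \in unitmx by rewrite even_coef_lead A0 unitmx1.
apply: for_large_sqrt; apply: for_largeW (mpeval_lead_unit_large u0) => z.
by rewrite Fe_evenE.
Qed.

Lemma Fo_odd_large : for_large (fun w => Fo_odd m A w \in unitmx).
Proof.
have u0 : even_coef m.*2.+1 A m.*2.+1 \in unitmx by rewrite even_coef_lead A0 unitmx1.
apply: for_large_sqrt.
apply: for_largeW (for_large_and (mpeval_lead_unit_large u0) (@for_large_neq0 R)).
by move=> z []; rewrite Fo_oddE => u z0; move: u; rewrite unitmxZ ?unitfE.
Qed.

Lemma Fe_odd_regular_large :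
  mx_regular (Fe_odd m A) -> for_large (fun w => Fe_odd m A w \in unitmx).
Proof.
move=> reg; apply: for_large_sqrt.
have : ~ forall z, \det (mpeval m.*2.+2 (odd_coef m.*2.+1 A) z) = 0.
  by move=> d0; apply: reg => w; rewrite -[w]sqrtCK -Fe_oddE.
by move/mpeval_regular_large; apply: for_largeW => z; rewrite Fe_oddE.
Qed.

Lemma hurwitz_even_expansion (s : nat -> M) : (0 < m)%N ->
    (forall k, (k < m.*2)%N -> is_hermitian (s k)) -> right_markov m A s ->
  hurwitz m.*2 A <-> exists c, all_posdef m.*2 c /\ for_large (fun w =>
    Rcf_invertible m.*2 zf_even_case c w /\
    Fe_even m A w = Rcf m.*2 zf_even_case c w 1 *m Fo_even m A w).
Proof.
move=> m0 hs mk.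
have iff c : all_posdef m.*2 c ->
    fraction_expansion m.*2 c (even_coef m.*2 A) (odd_coef m.*2 A) <->
    for_large (fun w => Rcf_invertible m.*2 zf_even_case c w /\
      Fe_even m A w = Rcf m.*2 zf_even_case c w 1 *m Fo_even m A w).
  move=> pc; apply: fraction_expansion_Rcf => //; first by lia.
    by rewrite /zf_even_case; lia.
  move=> z z0; exists 1; first exact: oner_neq0.
  by rewrite Fe_evenE Fo_evenE mul1r scale1r.
have H := @hurwitz_fraction_expansion R p m.*2 A s
  (fun w => w *: (Fo_even m A w *m invmx (Fe_even m A w))).
have {}H : hurwitz m.*2 A <-> exists c, all_posdef m.*2 c /\
     fraction_expansion m.*2 c (even_coef m.*2 A) (odd_coef m.*2 A).
  apply: H => //; first by lia.
    (* Multiplication by [w] turns the exponents [-(k+1)] of the Markov series into [-k]. *)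
    apply: for_largeW (for_large_and mk (@for_large_neq0 R)) => w [sw w0].
    apply: eq_mx_series_to (mx_series_to_scale w0 sw) => k.
    by rewrite scalerA mulrCA exprS invfM mulVKf.
  apply: for_largeW (@for_large_neq0 R) => z _.
  by rewrite Fe_evenE Fo_evenE -scalemxAl scalerA.
by rewrite H; split=> -[c [pc ex]]; exists c; split=> //; apply/(iff c pc).
Qed.

Lemma hurwitz_odd_expansion (s : nat -> M) : (0 < m)%N ->
    (forall k, (k < m.*2.+1)%N -> is_hermitian (s k)) -> right_markov2 m A s ->
  hurwitz m.*2.+1 A <-> exists c, all_posdef m.*2.+1 c /\ for_large (fun w =>
    Rcf_invertible m.*2.+1 zf_odd_case c w /\
    Fo_odd m A w = Rcf m.*2.+1 zf_odd_case c w 1 *m Fe_odd m A w).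
Proof.
move=> m0 hs mk.
have iff c : all_posdef m.*2.+1 c ->
    fraction_expansion m.*2.+1 c (even_coef m.*2.+1 A) (odd_coef m.*2.+1 A) <->
    for_large (fun w => Rcf_invertible m.*2.+1 zf_odd_case c w /\
      Fo_odd m A w = Rcf m.*2.+1 zf_odd_case c w 1 *m Fe_odd m A w).
  move=> pc; apply: fraction_expansion_Rcf => //; first by lia.
    by rewrite /zf_odd_case /= odd_double.
  move=> z z0; exists z => //.
  by rewrite Fo_oddE Fe_oddE /scale_factor /= mulfV // scale1r.
have H := @hurwitz_fraction_expansion R p m.*2.+1 A s
  (fun w => Fe_odd m A w *m invmx (Fo_odd m A w)).
have {}H : hurwitz m.*2.+1 A <-> exists c, all_posdef m.*2.+1 c /\
     fraction_expansion m.*2.+1 c (even_coef m.*2.+1 A) (odd_coef m.*2.+1 A).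
  apply: H => //.
  apply: for_largeW (for_large_and (for_large_sqr Fo_odd_large) (@for_large_neq0 R)).
  move=> z [uz z0]; rewrite Fe_oddE Fo_oddE invmxZ ?unitmxZ ?unitfE //.
  by rewrite -scalemxAr scalerA mulfV // scale1r.
by rewrite H; split=> -[c [pc ex]]; exists c; split=> //; apply/(iff c pc).
Qed.

End Quotients.

Theorem theorem4p11 (R : realType) (p n : nat) (A : nat -> 'M[complex R]_p)
    (s : nat -> 'M[complex R]_p) :
  (2 <= n)%N ->
  A 0%N = 1%:M ->
  (forall k : nat, (k < n)%N -> is_hermitian (s k)) ->
  (* (i) n = 2m *)
  ((~~ odd n) -> right_markov n./2 A s ->
     (hurwitz n A <->
      exists c : nat -> 'M[complex R]_p, all_posdef n c /\
        exists r : R, forall z : complex R, (r%:C)%C < `|z| ->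
          Rcf_invertible n zf_even_case c z /\
          Fo_even n./2 A z *m invmx (Fe_even n./2 A z)
            = invmx (Rcf n zf_even_case c z 1)))
  /\
  (* (ii) n = 2m+1 *)
  (odd n -> right_markov2 n./2 A s ->
     (hurwitz n A <->
      exists c : nat -> 'M[complex R]_p, all_posdef n c /\
        exists r : R, forall z : complex R, (r%:C)%C < `|z| ->
          Rcf_invertible n zf_odd_case c z /\
          Fe_odd n./2 A z *m invmx (Fo_odd n./2 A z)
            = invmx (Rcf n zf_odd_case c z 1))
     /\
     (hurwitz n A <->
      mx_regular (Fe_odd n./2 A) /\
      exists c : nat -> 'M[complex R]_p, all_posdef n c /\
        exists r : R, forall z : complex R, (r%:C)%C < `|z| ->
          Rcf_invertible n zf_odd_case c z /\
          Fo_odd n./2 A z *m invmx (Fe_odd n./2 A z)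
            = Rcf n zf_odd_case c z 1)).
Proof.
move=> n2 A0 hs; split=> on.
  have nE : n = n./2.*2 by rewrite -[LHS]odd_double_half (negbTE on).
  move: (n./2) nE => m nE mk; subst n.
  rewrite (hurwitz_even_expansion A0 _ hs mk); last by lia.
  have E c := for_large_quotient zf_even_case c (Fo_even m A) n2 (Fe_even_large m A0).
  by split=> -[c [pc ex]]; exists c; split=> //; apply/(E c).
have nE : n = n./2.*2.+1 by rewrite -[LHS]odd_double_half on.
move: (n./2) nE => m nE mk; subst n.
have uo := Fo_odd_large m A0.
have H := hurwitz_odd_expansion A0 (_ : (0 < m)%N) hs mk; have {}H := H ltac:(lia).
rewrite H; split.
  have E c := for_large_quotient zf_odd_case c (Fe_odd m A) n2 uo.
  by split=> -[c [pc ex]]; exists c; split=> //; apply/(E c).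
split=> [[c [pc ex]]|[reg [c [pc ex]]]].
  (* [F_o] is monic, hence invertible at large arguments, and [F_o = R_1 F_e] passes this on to
     [F_e]; regularity follows. *)
  have ue : for_large (fun w => Fe_odd m A w \in unitmx).
    apply: for_largeW (for_large_and uo ex) => w [u [_ E]].
    by move: u; rewrite E unitmx_mul => /andP[].
  split=> [d0|].
    have [w] := for_large_ex ue; by rewrite unitmxE d0 unitr0.
  exists c; split=> //; apply: for_largeW (for_large_and ue ex) => w [u [uR E]].
  by split=> //; rewrite E mulmxK.
exists c; split=> //.
apply: for_largeW (for_large_and (Fe_odd_regular_large reg) ex) => w [u [uR E]].
by split=> //; rewrite -E mulmxKV.
Qed.
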